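(* Let $a,b$ be positive integers. Let $\lambda=(\lambda_+,\lambda_-)$, $\mu=(\mu_+,\mu_-)$, $\nu=(\nu_+,\nu_-)$, where $\lambda_+,\mu_+,\nu_+$ are non-increasing integer sequences (with possibly negative entries) of lengths $ab$, $b$, $a$ respectively, and $\lambda_-,\mu_-,\nu_-$ are partitions of arbitrary length. Then the Kronecker coefficient $$g(\lambda+(t)^{ab},\ \mu+(at)^b,\ \nu+(bt)^a)$$ is a non-decreasing, eventually constant, function of the integer $t$ (where $t$ ranges over the values for which the three arguments are partitions, which holds for all large enough $t$).
   Context: Kronecker coefficients: for partitions $\alpha,\beta,\gamma$ of $n$, $g(\alpha,\beta,\gamma)=\dim([\alpha]\otimes[\beta]\otimes[\gamma])^{S_n}$, where $[\alpha]$ is the irreducible complex representation of the symmetric group $S_n$ indexed by $\alpha$; $g=0$ if the three sizes are not equal. $(m)^d$ denotes the sequence with $d$ entries equal to $m$, and it is added to the first $d$ entries: e.g. $\lambda+(t)^{ab}$ is obtained by adding $t$ to each of the $ab$ entries of $\lambda_+$ and leaving $\lambda_-$ unchanged. *)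

(* Defs.v *)
From HB Require Import structures.
From mathcomp Require Import all_boot all_order all_fingroup all_algebra.
From mathcomp Require Import mxrepresentation character.
From mathcomp Require Import reals.
From mathcomp Require Import complex.

Set Implicit Arguments.
Unset Strict Implicit.
Unset Printing Implicit Defensive.

Import Order.TTheory GRing.Theory Num.Theory.

Local Open Scope ring_scope.

(* Trailing zeros are allowed in partitions; they are immaterial below. *)
Definition is_partition (s : seq int) : bool :=
  sorted >=%R s && all (fun x => 0 <= x) s.

(* s + (m)^d *)
Definition add_first (d : nat) (m : int) (s : seq int) : seq int :=
  [seq x + m | x <- take d s] ++ drop d s.

Section Specht.

Variables (C : fieldType) (n : nat) (al : seq nat).

(* Boxes of the diagram of al are numbered 0, ..., n - 1 row by row, from left
   to right; for a partition al of n, box i lies in row reshape_index al i and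
   in column reshape_offset al i. *)
Definition row_stab : {set 'S_n} :=
  [set s : 'S_n | [forall i, reshape_index al (s i) == reshape_index al i]].

Definition col_stab : {set 'S_n} :=
  [set s : 'S_n | [forall i, reshape_offset al (s i) == reshape_offset al i]].

(* The Young symmetrizer c = a b, where a is the sum of the p in row_stab and b
   the sum of the sgn(q) q for q in col_stab, in the coordinates used by
   regular_repr. As (q * p) i = p (q i) in 'S_n, the permutation q * p is the
   composite p o q, i.e., the product pq in the usual convention. *)
Definition young_symmetrizer : 'rV[C]_#|[set: 'S_n]| :=
  \sum_(p in row_stab) \sum_(q in col_stab)
    (-1) ^+ odd_perm q *: delta_mx 0 (gring_index [set: 'S_n] (q * p)%g).

(* The submodule of the regular module generated by c. Here g maps e_x to
   e_(x * g), and x * g is g o x: in the usual convention this is the left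
   ideal C[S_n] c with the action of S_n by left multiplication, i.e., the
   irreducible module [al] (al = (n) gives the trivial one). *)
Definition specht_repr :=
  submod_repr
    (cyclic_mx_module (regular_repr C [set: 'S_n]) young_symmetrizer).

Definition specht : representation C [set: 'S_n] :=
  Representation specht_repr.

End Specht.

(* dim ([al] (x) [be] (x) [ga])^(S_n); only meaningful on partitions. *)
Definition kronecker (R : realType) (al be ga : seq nat) : nat :=
  let n := sumn al in
  if (sumn be == n) && (sumn ga == n) then
    let V := prod_repr (Representation
                 (prod_repr (specht R[i] n al) (specht R[i] n be)))
               (specht R[i] n ga) in
    \rank (rfix_mx V [set: 'S_n])
  else 0%N.

(* The parts of an integer sequence; used on partitions only. *)
Definition parts (s : seq int) : seq nat := [seq `|x|%N | x <- s].

(* Main.v *)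
Require Import Defs.
From mathcomp Require Import all_boot all_order all_fingroup all_algebra.
From mathcomp Require Import mxrepresentation character.
From mathcomp Require Import reals complex.
From mathcomp Require Import mpoly zify.

Set Implicit Arguments.
Unset Strict Implicit.
Unset Printing Implicit Defensive.

Import Order.TTheory GRing.Theory Num.Theory.

Local Open Scope ring_scope.

(** The Kronecker coefficient of three partitions of n is the dimension of a
    space of explicit polynomials in variables x_ijk. Place n points bijectively
    in the boxes of each of the three diagrams, by y1, y2, y3; the polynomial
    [young_poly] of this placement is the signed sum, over the triples
    (q1, q2, q3) of permutations of the boxes preserving the columns, of the
    monomials with one factor x_(row(q1(y1 k)), row(q2(y2 k)), row(q3(y3 k)))
    for each point k. The irreducible modules are spanned by the translates of a
    Young symmetrizer, a row sum times a signed column sum. Written on these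
    translates, the projection of the triple tensor product onto its invariants
    is a matrix whose columns are, up to nonzero scalings of the coordinates, the
    coefficient vectors of these polynomials ([kronecker_family_rank]).

    Monotonicity. The stabilizer of the columns of a juxtaposition of diagrams
    is a product, so juxtaposing tableaux multiplies polynomials
    ([tabpoly_join]). Adding m to the first d parts of a partition inserts m
    columns of height d. Going from t to t + 1 therefore multiplies all the
    polynomials by one of the polynomials of the triple ((1)^ab, (a)^b, (b)^a).
    That polynomial is nonzero ([block_poly_neq0]): one of its coefficients is,
    up to a positive factor, a sum of squares
    ([signed_double_coset_sum_gt0]). As polynomials form an integral domain,
    linear independence is preserved, and the coefficient does not decrease
    ([kronecker_grow]).

    Boundedness. For large t almost all columns of the first diagram have height
    exactly ab. At most |mu_-| + |nu_-| points lie below row b of the second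
    diagram or below row a of the third one, whatever the permutations q2 and
    q3 are; the other points carry labels (j, k) in a b x a grid. A column of
    height ab all of whose labels are in the grid contributes, after summing
    over the permutations of that column, a determinant with one row for each
    of its labels, hence 0 or plus or minus the determinant of the ab x ab matrix
    of the x_(i,(j,k)). So all the polynomials are divisible by a
    power of this determinant, with a quotient of bounded degree
    ([young_poly_divides]), and the coefficient is bounded ([kronecker_bound]).

    A bounded nondecreasing sequence of natural numbers is eventually
    constant. *)

(** * Alternating sums over fibre-preserving permutations *)

Section ExtendPerm.

Variables (I J : finType) (f : I -> J) (f_inj : injective f).

Definition extend_fun (q : {perm I}) (j : J) : J :=
  if [pick i | f i == j] is Some i then f (q i) else j.

Lemma extend_funE q i : extend_fun q (f i) = f (q i).
Proof.
rewrite /extend_fun; case: pickP => [i' /eqP/f_inj-> // | /(_ i)].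
by rewrite eqxx.
Qed.

Lemma extend_fun_id q j : (forall i, f i != j) -> extend_fun q j = j.
Proof. by move=> nj; rewrite /extend_fun; case: pickP => // i; rewrite (negPf (nj i)). Qed.

Lemma extend_fun_cases j : (exists i, j = f i) \/ (forall i, f i != j).
Proof.
have [/existsP[i /eqP<-]|/existsPn] := boolP [exists i, f i == j].
  by left; exists i.
by right.
Qed.

Lemma extend_funK q : cancel (extend_fun q) (extend_fun q^-1).
Proof.
move=> j; have [[i ->]|nj] := extend_fun_cases j.
  by rewrite !extend_funE permK.
by rewrite !extend_fun_id.
Qed.

Definition extend_perm q : {perm J} := perm (can_inj (extend_funK q)).

Lemma extend_permE q i : extend_perm q (f i) = f (q i).
Proof. by rewrite permE extend_funE. Qed.

Lemma extend_perm_id q j : (forall i, f i != j) -> extend_perm q j = j.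
Proof. by move=> nj; rewrite permE extend_fun_id. Qed.

Lemma extend_permM q q' : extend_perm (q * q') = (extend_perm q * extend_perm q')%g.
Proof.
apply/permP => j; rewrite permM; have [[i ->]|nj] := extend_fun_cases j.
  by rewrite !extend_permE permM.
by rewrite !extend_perm_id.
Qed.

Lemma extend_tperm i i' : extend_perm (tperm i i') = tperm (f i) (f i').
Proof.
apply/permP => j; have [[k ->]|nj] := extend_fun_cases j.
  by rewrite extend_permE -(inj_tperm _ _ _ f_inj).
by rewrite extend_perm_id // tpermD.
Qed.

(** Extension is multiplicative and maps transpositions to transpositions, so the
    parity can be read on any decomposition into transpositions. *)
Lemma odd_extend_perm q : odd_perm (extend_perm q) = odd_perm q.
Proof.
have [ts -> _] := prod_tpermP q.
elim: ts => [|t ts IHts].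
  rewrite !big_nil odd_perm1 [extend_perm 1](_ : _ = 1%g) ?odd_perm1 //.
  by apply: (mulgI (extend_perm 1)); rewrite -extend_permM !mulg1.
by rewrite big_cons extend_permM !odd_permM IHts extend_tperm !odd_tperm (inj_eq f_inj).
Qed.

End ExtendPerm.

Section AlternatingSums.

Variable A : comNzRingType.

Definition fibre_perms (I : finType) (T : eqType) (c : I -> T) : {set {perm I}} :=
  [set q : {perm I} | [forall i, c (q i) == c i]].

Lemma fibre_permP (I : finType) (T : eqType) (c : I -> T) (q : {perm I}) :
  reflect (forall i, c (q i) = c i) (q \in fibre_perms c).
Proof. by rewrite inE; apply: (iffP forallP) => H i; apply/eqP/H. Qed.

Definition altsum (I : finType) (T : eqType) (c : I -> T) (F : {perm I} -> A) : A :=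
  \sum_(q in fibre_perms c) (-1) ^+ odd_perm q * F q.

(** Only the partition into fibres of c matters; this is what allows columns to
    be renumbered. *)
Lemma eq_altsum (I : finType) (T T' : eqType) (c : I -> T) (c' : I -> T') F F' :
    (forall i i', (c i == c i') = (c' i == c' i')) -> F =1 F' ->
  altsum c F = altsum c' F'.
Proof.
move=> Ec EF; apply: eq_big => [q|q _]; last by rewrite EF.
by rewrite !inE; apply: eq_forallb => i; rewrite Ec.
Qed.

Lemma altsum_prod (I I' : finType) (T T' : eqType) (c : I -> T) (c' : I' -> T') F F' :
  altsum c (fun q => altsum c' (fun q' => F q * F' q')) = altsum c F * altsum c' F'.
Proof.
rewrite /altsum mulr_suml; apply: eq_bigr => q _; rewrite mulr_sumr.
rewrite mulr_sumr; apply: eq_bigr => q' _.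
by rewrite -!mulrA; congr (_ * _); rewrite mulrCA.
Qed.

Lemma altsumZ (I : finType) (T : eqType) (c : I -> T) a F :
  altsum c (fun q => a * F q) = a * altsum c F.
Proof. by rewrite /altsum mulr_sumr; apply: eq_bigr => q _; rewrite mulrCA. Qed.

Section Split.

Variables (I1 I2 J : finType) (f1 : I1 -> J) (f2 : I2 -> J).

Definition join_fun (s : I1 + I2) : J :=
  match s with inl i => f1 i | inr i => f2 i end.

Hypothesis f_bij : bijective join_fun.

Lemma join_injl : injective f1.
Proof. by move=> i i' E; have [] := @bij_inj _ _ _ f_bij (inl i) (inl i') E. Qed.

Lemma join_injr : injective f2.
Proof. by move=> i i' E; have [] := @bij_inj _ _ _ f_bij (inr i) (inr i') E. Qed.

Lemma join_disjoint i1 i2 : f1 i1 != f2 i2.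
Proof. by apply/eqP => E; have := @bij_inj _ _ _ f_bij (inl i1) (inr i2) E. Qed.

Lemma join_cases j : (exists i, j = f1 i) \/ (exists i, j = f2 i).
Proof.
case: f_bij => g _ gK; rewrite -(gK j).
by case: (g j) => i; [left | right]; exists i.
Qed.

Lemma big_join (F : J -> A) :
  \prod_j F j = (\prod_i F (f1 i)) * \prod_i F (f2 i).
Proof.
have [g fK gK] := f_bij.
rewrite (reindex join_fun) /=; last by exists g => s _.
by rewrite big_sumType.
Qed.

Definition join_perm (q : {perm I1} * {perm I2}) : {perm J} :=
  (extend_perm join_injl q.1 * extend_perm join_injr q.2)%g.

Lemma join_permEl q i : join_perm q (f1 i) = f1 (q.1 i).
Proof.
rewrite permM extend_permE extend_perm_id // => i2.
by rewrite eq_sym join_disjoint.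
Qed.

Lemma join_permEr q i : join_perm q (f2 i) = f2 (q.2 i).
Proof.
rewrite permM [X in extend_perm _ _ X]extend_perm_id ?extend_permE // => i1.
exact: join_disjoint.
Qed.

Lemma odd_join_perm q : odd_perm (join_perm q) = odd_perm q.1 (+) odd_perm q.2.
Proof. by rewrite odd_permM !odd_extend_perm. Qed.

Lemma join_perm_inj : injective join_perm.
Proof.
move=> q q' /permP E; case: q q' E => [q1 q2] [q1' q2'] E.
congr pair; apply/permP => i.
  by have := E (f1 i); rewrite !join_permEl => /join_injl.
by have := E (f2 i); rewrite !join_permEr => /join_injr.
Qed.

Variables (T : eqType) (c : J -> T).
Hypothesis c_disj : forall i1 i2, c (f1 i1) != c (f2 i2).

Lemma join_perm_fibre q :
  (join_perm q \in fibre_perms c) =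
  (q.1 \in fibre_perms (c \o f1)) && (q.2 \in fibre_perms (c \o f2)).
Proof.
apply/fibre_permP/andP => [cq | [/fibre_permP cq1 /fibre_permP cq2] j].
  split; apply/fibre_permP => i /=.
    by rewrite -join_permEl.
  by rewrite -join_permEr.
by have [[i ->]|[i ->]] := join_cases j; rewrite ?join_permEl ?join_permEr;
  [apply: cq1 | apply: cq2].
Qed.

(** Disjointness of the values of c on the two parts is used here: a permutation
    preserving the fibres cannot move a point from one part to the other. *)
Lemma fibre_perm_join q : q \in fibre_perms c -> exists q', join_perm q' = q.
Proof.
move=> /fibre_permP cq.
have st1 i : exists i', q (f1 i) == f1 i'.
  have [[i' ->]|[i' E]] := join_cases (q (f1 i)); first by exists i'.
  by have /eqP[] := c_disj i i'; rewrite -E cq.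
have st2 i : exists i', q (f2 i) == f2 i'.
  have [[i' E]|[i' ->]] := join_cases (q (f2 i)); last by exists i'.
  by have /eqP[] := c_disj i' i; rewrite -E cq.
pose g1 i := xchoose (st1 i); pose g2 i := xchoose (st2 i).
have g1E i : q (f1 i) = f1 (g1 i) by apply/eqP/(xchooseP (st1 i)).
have g2E i : q (f2 i) = f2 (g2 i) by apply/eqP/(xchooseP (st2 i)).
have g1_inj : injective g1.
  by move=> i i' E; apply/join_injl/(@perm_inj _ q); rewrite !g1E E.
have g2_inj : injective g2.
  by move=> i i' E; apply/join_injr/(@perm_inj _ q); rewrite !g2E E.
exists (perm g1_inj, perm g2_inj); apply/permP => j.
by have [[i ->]|[i ->]] := join_cases j; rewrite ?join_permEl ?join_permEr /= permE ?g1E ?g2E.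
Qed.

(** The fibre-preserving permutations of a disjoint union of unions of fibres are
    the pairs of such permutations of both parts, and signs multiply. *)
Lemma altsum_join (F : {perm J} -> A) :
  altsum c F =
  altsum (c \o f1) (fun q1 => altsum (c \o f2) (fun q2 => F (join_perm (q1, q2)))).
Proof.
rewrite /altsum; under [RHS]eq_bigr do rewrite mulr_sumr.
rewrite pair_big_dep /=.
have -> : fibre_perms c =
    join_perm @: [set q | (q.1 \in fibre_perms (c \o f1))
                       && (q.2 \in fibre_perms (c \o f2))].
  apply/setP => q; apply/idP/imsetP => [cq | [q' cq' ->]].
    have [q' Dq] := fibre_perm_join cq; exists q' => //.
    by rewrite inE -join_perm_fibre Dq.
  by rewrite join_perm_fibre; rewrite inE in cq'.
rewrite big_imset /=; last by move=> q q' _ _; apply: join_perm_inj.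
apply: eq_big => [[q1 q2]|[q1 q2] _]; first by rewrite inE.
by rewrite odd_join_perm signr_addb mulrA.
Qed.

End Split.

End AlternatingSums.

Lemma altsum_sum (A : comNzRingType) (I X : finType) (T : eqType) (c : I -> T)
    (F : X -> {perm I} -> A) :
  \sum_x altsum c (F x) = altsum c (fun q => \sum_x F x q).
Proof. by rewrite /altsum exchange_big; apply: eq_bigr => q _; rewrite mulr_sumr. Qed.

Lemma altsum_prod3 (A : comNzRingType) (I1 I2 I3 : finType) (T1 T2 T3 : eqType)
    (c1 : I1 -> T1) (c2 : I2 -> T2) (c3 : I3 -> T3)
    (F1 : {perm I1} -> A) (F2 : {perm I2} -> A) (F3 : {perm I3} -> A) :
  altsum c1 F1 * altsum c2 F2 * altsum c3 F3 =
  altsum c1 (fun q1 => altsum c2 (fun q2 => altsum c3 (fun q3 =>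
    F1 q1 * F2 q2 * F3 q3))).
Proof.
rewrite -mulrA -altsum_prod -altsum_prod.
apply: eq_altsum => // q1; apply: eq_altsum => // q2.
by rewrite -altsumZ; apply: eq_altsum => // q3; rewrite mulrA.
Qed.

Lemma altsum_exchange (A : comNzRingType) (I J : finType) (T U : eqType)
    (c : I -> T) (c' : J -> U) (F : {perm I} -> {perm J} -> A) :
  altsum c (fun q => altsum c' (F q)) = altsum c' (fun q' => altsum c (F^~ q')).
Proof.
rewrite /altsum; under eq_bigr do rewrite mulr_sumr.
rewrite exchange_big; apply: eq_bigr => q' _ /=; rewrite mulr_sumr.
by apply: eq_bigr => q _; rewrite mulrCA.
Qed.

Lemma altsum_intr (K : comNzRingType) (I : finType) (T : eqType) (c : I -> T)
    (F : {perm I} -> int) :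
  (altsum c F)%:~R = altsum c (fun q => (F q)%:~R) :> K.
Proof.
rewrite /altsum rmorph_sum; apply: eq_bigr => q _.
by rewrite rmorphM rmorph_sign.
Qed.

(** * Polynomials attached to triples of tableaux *)

(** A filling of a diagram by the points of J. The type of boxes is kept apart
    from J because column permutations act on boxes, which differ for the three
    tableaux of a triple, while the points are shared by the triple. *)
Record tableau (J : finType) := Tableau {
  box : finType; tab_row : box -> nat; tab_col : box -> nat; place : J -> box }.

Section TableauPolynomial.

Variables (A : comNzRingType) (x : nat -> nat -> nat -> A).

(** Up to scalars, the image of a triple of polytabloids in the symmetric algebra:
    forgetting the order of the points is taking coinvariants under the diagonal
    symmetric group. *)
Definition tabpoly (J : finType) (t1 t2 t3 : tableau J) : A :=
  altsum (@tab_col _ t1) (fun q1 => altsum (@tab_col _ t2) (fun q2 =>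
    altsum (@tab_col _ t3) (fun q3 =>
      \prod_j x (tab_row (q1 (place t1 j))) (tab_row (q2 (place t2 j)))
                (tab_row (q3 (place t3 j)))))).

Section Join.

Variables (J1 J2 J : finType) (g1 : J1 -> J) (g2 : J2 -> J).

(** The tableau t is the juxtaposition of u and v, up to a renumbering of columns
    that does not merge any two of them. *)
Record tab_join (t : tableau J) (u : tableau J1) (v : tableau J2) : Prop :=
    TabJoin {
  tab_f1 : box u -> box t;
  tab_f2 : box v -> box t;
  tab_bij : bijective (join_fun tab_f1 tab_f2);
  tab_col_disj : forall i1 i2, tab_col (tab_f1 i1) != tab_col (tab_f2 i2);
  tab_col1 : forall i i',
    (tab_col (tab_f1 i) == tab_col (tab_f1 i')) = (tab_col i == tab_col i');
  tab_col2 : forall i i',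
    (tab_col (tab_f2 i) == tab_col (tab_f2 i')) = (tab_col i == tab_col i');
  tab_row1 : forall i, tab_row (tab_f1 i) = tab_row i;
  tab_row2 : forall i, tab_row (tab_f2 i) = tab_row i;
  tab_place1 : forall j, place t (g1 j) = tab_f1 (place u j);
  tab_place2 : forall j, place t (g2 j) = tab_f2 (place v j) }.

Hypothesis g_bij : bijective (join_fun g1 g2).

(** Each of the three alternating sums splits by [altsum_join], and so does the
    monomial. *)
Lemma tabpoly_join t1 t2 t3 u1 u2 u3 v1 v2 v3 :
    tab_join t1 u1 v1 -> tab_join t2 u2 v2 -> tab_join t3 u3 v3 ->
  tabpoly t1 t2 t3 = tabpoly u1 u2 u3 * tabpoly v1 v2 v3.
Proof.
case=> f1 h1 fh1 d1 c1 e1 r1 s1 p1 k1.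
case=> f2 h2 fh2 d2 c2 e2 r2 s2 p2 k2.
case=> f3 h3 fh3 d3 c3 e3 r3 s3 p3 k3.
rewrite /tabpoly (altsum_join fh1) // -altsum_prod.
apply: eq_altsum => [i i'|q1]; first exact: c1.
apply: eq_altsum => [i i'|q1']; first exact: e1.
rewrite (altsum_join fh2) // -altsum_prod.
apply: eq_altsum => [i i'|q2]; first exact: c2.
apply: eq_altsum => [i i'|q2']; first exact: e2.
rewrite (altsum_join fh3) // -altsum_prod.
apply: eq_altsum => [i i'|q3]; first exact: c3.
apply: eq_altsum => [i i'|q3']; first exact: e3.
rewrite (big_join g_bij); congr (_ * _); apply: eq_bigr => j _.
  by rewrite p1 p2 p3 !join_permEl r1 r2 r3.
by rewrite k1 k2 k3 !join_permEr s1 s2 s3.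
Qed.

End Join.

End TableauPolynomial.

(** * Monomials and their contents *)

Section Content.

Variable V : nat.

(** The exponent of the monomial that is the product of the variables listed by l. *)
Definition content (J : finType) (l : J -> 'I_V) : 'X_{1..V} := (\sum_j U_(l j))%MM.

Lemma contentE (J : finType) (l : J -> 'I_V) v : content l v = #|[pred j | l j == v]|.
Proof.
rewrite mnm_sumE -sum1_card [RHS]big_mkcond /=.
by apply: eq_bigr => j _; rewrite mnm1E inE; case: (_ == _).
Qed.

Lemma prod_mpolyX (K : comNzRingType) (J : finType) (l : J -> 'I_V) :
  \prod_j 'X_(l j) = 'X_[content l] :> {mpoly K[V]}.
Proof.
rewrite /content.
by elim/big_ind2: _ => [|m p m' p' -> ->|//]; rewrite ?mpolyX0 ?mpolyXD.
Qed.

Variable n : nat.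
Implicit Types l : 'I_n -> 'I_V.

Lemma content_permP l l' :
  reflect (exists p : 'S_n, forall k, l (p k) = l' k) (content l == content l').
Proof.
apply: (iffP eqP) => [E | [p E]]; last first.
  apply/mnmP => v; rewrite !contentE -(card_imset _ (@perm_inj _ p^-1%g)).
  apply: eq_card => k; rewrite inE -E; apply/imsetP/eqP => [[j] | <-].
    by rewrite inE => /eqP<- ->; rewrite permKV.
  by exists (p k); rewrite ?inE ?permK.
have : perm_eq [tuple l' i | i < n] [tuple l i | i < n].
  have countE k v : count_mem v [tuple k i | i < n] = content k v.
    rewrite contentE -sum1_card -sum1_count big_map big_enum_cond.
    by apply: eq_bigl => j; rewrite !inE.
  by apply/allP => v _; rewrite /= !countE E.
case/tuple_permP => p Dl'; exists p => k.
have /(congr1 (fun t => tnth t k)) := val_inj Dl'.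
by rewrite !tnth_mktuple.
Qed.

(** When nonempty, the set on the left is a coset of the stabilizer of l. *)
Lemma card_relabel l l' :
  #|[set p : 'S_n | [forall k, l (p k) == l' k]]| =
  (#|[set p : 'S_n | [forall k, l (p k) == l k]]| * (content l == content l'))%N.
Proof.
have [[p Dl'] | nl] := content_permP l l'; last first.
  rewrite muln0; apply/eqP; rewrite cards_eq0; apply/set0Pn => -[p].
  by rewrite inE => /forallP lp; case: nl; exists p => k; apply/eqP.
rewrite muln1 -[RHS](card_imset _ (mulgI p)); apply: eq_card => q.
rewrite inE; apply/forallP/imsetP => [lq | [r]].
  exists (p^-1 * q)%g; last by rewrite mulKVg.
  rewrite inE; apply/forallP => k.
  have /eqP := lq ((p^-1)%g k).
  by rewrite permM -Dl' permKV => ->.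
by rewrite inE => /forallP lr -> k; rewrite permM -Dl'.
Qed.

End Content.

Lemma mdeg_content V (J : finType) (l : J -> 'I_V) : mdeg (content l) = #|J|.
Proof.
rewrite /content mdeg_sum -sum1_card; apply: eq_bigr => j _; exact: mdeg1.
Qed.

Lemma mcoeff_altsum (K : comNzRingType) V (m : 'X_{1..V}) (I : finType)
    (T : eqType) (c : I -> T) (F : {perm I} -> {mpoly K[V]}) :
  (altsum c F)@_m = altsum c (fun q => (F q)@_m).
Proof.
rewrite /altsum raddf_sum; apply: eq_bigr => q _ /=.
by case: (odd_perm q); rewrite ?expr1 ?expr0 ?mulN1r ?mul1r ?mcoeffN.
Qed.

(** * Rank of a family of vectors *)

(** The dimension of the span of P, expressed through the linear relations
    between its members, so that V may be infinite dimensional. *)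
Definition family_rank (K : fieldType) (V : lmodType K) k (P : 'I_k -> V) d :=
  exists m (M : 'M[K]_(k, m)), \rank M = d /\
    forall c : 'rV_k, c *m M = 0 <-> \sum_i c 0 i *: P i = 0.

(** The left kernel of N is contained in that of M. *)
Lemma rank_le_of_relations (K : fieldType) k m m' (M : 'M[K]_(k, m)) (N : 'M[K]_(k, m')) :
    (forall c : 'rV_k, c *m N = 0 -> c *m M = 0) ->
  (\rank M <= \rank N)%N.
Proof.
move=> NM; have : (kermx N <= kermx M)%MS.
  apply/rV_subP => c /sub_kermxP/NM cM; exact/sub_kermxP.
move/mxrankS; rewrite !mxrank_ker leq_sub2lE ?rank_leq_row //.
Qed.

Lemma family_rank_le (K : fieldType) (V V' : lmodType K) k k' (P : 'I_k -> V)
    (P' : 'I_k' -> V') (phi : 'I_k -> 'I_k') d d' :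
    family_rank P d -> family_rank P' d' ->
    (forall c : 'I_k -> K, \sum_i c i *: P' (phi i) = 0 -> \sum_i c i *: P i = 0) ->
  (d <= d')%N.
Proof.
case=> m [M [<- MP]] [m' [M' [<- MP']]] PP'.
apply: leq_trans (mxrankM_maxr (rowsub phi 1%:M) M').
apply: rank_le_of_relations => c; rewrite mulmxA => /MP' E; apply/MP/PP'.
rewrite -[RHS]E; under [RHS]eq_bigr do rewrite mxE scaler_suml.
rewrite exchange_big; apply: eq_bigr => i _ /=.
rewrite (bigD1 (phi i)) //= big1 => [|j nj].
  by rewrite !mxE eqxx mulr1 addr0.
by rewrite !mxE eq_sym (negPf nj) mulr0 scale0r.
Qed.

Lemma family_rank_bound (K : fieldType) (V : lmodType K) k (P : 'I_k -> V) d
    n D (Q : 'I_k -> {mpoly K[n]}) :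
    family_rank P d -> (forall i, (msize (Q i) <= D)%N) ->
    (forall c : 'I_k -> K, \sum_i c i *: Q i = 0 -> \sum_i c i *: P i = 0) ->
  (d <= #|{: 'X_{1..n < D}}|)%N.
Proof.
case=> m [M [<- MP]] QD PQ.
pose N := \matrix_(i < k, j < #|{: 'X_{1..n < D}}|) (Q i)@_(enum_val j).
apply: leq_trans (rank_leq_col N).
apply: rank_le_of_relations => c /rowP cN; apply/MP/PQ/mpolyP => u.
rewrite mcoeff0 (raddf_sum (mcoeff u)).
have [uD|uD] := ltnP (mdeg u) D; last first.
  rewrite big1 // => i _; rewrite /= mcoeffZ.
  rewrite [_@__](_ : _ = 0) ?mulr0 //.
  apply/memN_msupp_eq0/negP => /msize_mdeg_lt.
  by rewrite ltnNge (leq_trans (QD i)).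
have := cN (enum_rank (BMultinom uD)); rewrite !mxE => E; rewrite -[RHS]E.
by apply: eq_bigr => i _; rewrite mxE enum_rankK /= mcoeffZ.
Qed.

(** * Invariants of tensor products as a matrix rank *)

Section TensorEntries.

Variable F : fieldType.

Lemma trowE n1 (A : 'rV[F]_n1) m2 n2 (B : 'M[F]_(m2, n2)) i (j1 : 'I_n1) (j2 : 'I_n2)
    (j : 'I_(n1 * n2)) :
  j = (j1 * n2 + j2)%N :> nat -> trow A B i j = A 0 j1 * B i j2.
Proof.
elim: n1 => [|n1 IHn] in A j1 j *; first by case: j1.
move=> Dj /=; rewrite mxE; case: splitP => k Dk.
  have j1_0 : j1 = lshift n1 (0 : 'I_1).
    apply/val_inj => /=; apply/eqP; rewrite -leqn0 leqNgt; apply/negP => j1_gt0.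
    have : (n2 <= j)%N by rewrite Dj (leq_trans _ (leq_addr _ _)) // leq_pmull.
    by rewrite Dk leqNgt ltn_ord.
  rewrite !mxE -j1_0; congr (_ * B i _); apply/val_inj => /=.
  by rewrite -Dk Dj j1_0 mul0n.
case: (split_ordP (j1 : 'I_(1 + n1))) => [j0|j1' def_j1].
  rewrite ord1 => j1_0; have:= ltn_ord j2.
  by rewrite -(ltn_add2l (j1 * n2)) -Dj j1_0 mul0n Dk add0n ltnNge leq_addr.
rewrite (IHn _ j1') ?mxE ?def_j1 //; apply/eqP; rewrite -(eqn_add2l n2) -Dk Dj.
by rewrite def_j1 /= mulSn addnA.
Qed.

(** The recursive definition of [tprod] orders pairs of indices
    lexicographically. *)
Lemma tprod_entry m1 n1 (A : 'M[F]_(m1, n1)) m2 n2 (B : 'M[F]_(m2, n2))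
    (i1 : 'I_m1) (i2 : 'I_m2) (j1 : 'I_n1) (j2 : 'I_n2) (i : 'I_(m1 * m2)) (j : 'I_(n1 * n2)) :
  i = (i1 * m2 + i2)%N :> nat -> j = (j1 * n2 + j2)%N :> nat ->
  tprod A B i j = A i1 j1 * B i2 j2.
Proof.
elim: m1 => [|m1 IHm] in A i1 i *; first by case: i1.
move=> Di Dj /=; rewrite mxE; case: splitP => k Dk.
  have i1_0 : i1 = lshift m1 (0 : 'I_1).
    apply/val_inj => /=; apply/eqP; rewrite -leqn0 leqNgt; apply/negP => i1_gt0.
    have : (m2 <= i)%N by rewrite Di (leq_trans _ (leq_addr _ _)) // leq_pmull.
    by rewrite Dk leqNgt ltn_ord.
  rewrite (trowE _ _ _ Dj) mxE -i1_0; congr (_ * B _ _); apply/val_inj => /=.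
  by rewrite -Dk Di i1_0 mul0n.
case: (split_ordP (i1 : 'I_(1 + m1))) => [i0|i1' def_i1].
  rewrite ord1 => i1_0; have:= ltn_ord i2.
  by rewrite -(ltn_add2l (i1 * m2)) -Di i1_0 mul0n Dk add0n ltnNge leq_addr.
rewrite (IHm _ i1' k) ?mxE ?def_i1 //; apply/eqP; rewrite -(eqn_add2l m2) -Dk Di.
by rewrite def_i1 /= mulSn addnA.
Qed.

Lemma tprod_row_free m1 n1 (A : 'M[F]_(m1, n1)) m2 n2 (B : 'M[F]_(m2, n2)) :
  row_free A -> row_free B -> row_free (tprod A B).
Proof.
move=> /row_freeP[A' AA'] /row_freeP[B' BB']; apply/row_freeP.
by exists (tprod A' B'); rewrite -tprodE AA' BB' tprod1.
Qed.

Lemma tprod_submx m1 m1' n1 (A : 'M[F]_(m1, n1)) (A' : 'M[F]_(m1', n1))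
    m2 m2' n2 (B : 'M[F]_(m2, n2)) (B' : 'M[F]_(m2', n2)) :
  (A <= A')%MS -> (B <= B')%MS -> (tprod A B <= tprod A' B')%MS.
Proof. by case/submxP=> X -> /submxP[Y ->]; rewrite tprodE submxMl. Qed.

End TensorEntries.

(** Up to the factor |G|, the sum of the group elements is a projector onto the
    fixed points. *)
Lemma rank_rfix (F : fieldType) (gT : finGroupType) (G : {group gT}) n
    (rG : mx_representation F G n) :
  #|G|%:R != 0 :> F ->
  \rank (rfix_mx rG G) = \rank (\sum_(x in G) rG x)%R.
Proof.
move=> nzG; set S := \sum_(x in G) _; apply: eqmx_rank; apply/andP; split.
  have := rfix_mx_id rG; set W := rfix_mx rG G => fixW.
  have DW : W *m S = #|G|%:R *: W.
    rewrite /S mulmx_sumr (eq_bigr (fun=> W)) ?sumr_const ?scaler_nat //.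
    by move=> x Gx; exact: (fixW G).
  have /eqmxP/andP[_ W_le] := eqmx_scale W nzG.
  by apply: submx_trans W_le _; rewrite -DW; apply: submxMl.
apply/rfix_mxP => y Gy; rewrite /S mulmx_suml.
rewrite [RHS](reindex_inj (mulIg y)) /=.
by apply: eq_big => [x|x Gx]; rewrite ?groupMr ?repr_mxM.
Qed.

Section TensorInvariants.

Variables (C : fieldType) (gT : finGroupType) (G : {group gT}) (N : nat).
Variable aG : mx_representation C G N.
Hypothesis nzG : #|G|%:R != 0 :> C.

(** The representation rG is isomorphic to the submodule of aG spanned by the
    rows of Z. *)
Definition spanned_by (rG : representation C G) m (Z : 'M[C]_(m, N)) :=
  exists2 B : 'M[C]_(rdegree rG, N),
    row_free B /\ (B :=: Z)%MS & {in G, forall x, rG x *m B = B *m aG x}.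

(** The tensor product of the three embeddings is injective and intertwines the
    sums over G, so the rank can be computed inside the tensor cube of aG, where
    the bases of the submodules may be replaced by any spanning sets. *)
Lemma tensor_invariants_rank (r1 r2 r3 : representation C G) m1 m2 m3
    (Z1 : 'M[C]_(m1, N)) (Z2 : 'M[C]_(m2, N)) (Z3 : 'M[C]_(m3, N)) :
    spanned_by r1 Z1 -> spanned_by r2 Z2 -> spanned_by r3 Z3 ->
  \rank (rfix_mx (prod_repr (Representation (prod_repr r1 r2)) r3) G) =
  \rank (\sum_(x in G)
           tprod (tprod (Z1 *m aG x) (Z2 *m aG x)) (Z3 *m aG x))%R.
Proof.
case=> [A [freeA eqA] actA] [B [freeB eqB] actB] [D [freeD eqD] actD].
rewrite rank_rfix //.
have freeT : row_free (tprod (tprod A B) D) by rewrite !tprod_row_free.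
rewrite -(mxrankMfree _ freeT) mulmx_suml.
rewrite (eq_bigr (fun x => tprod (tprod A B) D *m
                           tprod (tprod (aG x) (aG x)) (aG x))); last first.
  by move=> x Gx; rewrite /= -!tprodE -actA -?actB -?actD.
rewrite -mulmx_sumr.
set M := \sum_(x in G) _.
have eqT : (tprod (tprod A B) D :=: tprod (tprod Z1 Z2) Z3)%MS.
  by apply/eqmxP/andP; split; rewrite !tprod_submx ?eqA ?eqB ?eqD.
rewrite (eqmxMr M eqT) mulmx_sumr.
by congr (\rank _); apply: eq_bigr => x _; rewrite -!tprodE.
Qed.

End TensorInvariants.

Section SpechtRank.

Variables (C : fieldType) (n : nat) (al : seq nat).
Local Notation G := [set: 'S_n].
Local Notation aG := (regular_repr C G).

Definition specht_translates : 'M[C]_#|G| :=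
  \matrix_i (young_symmetrizer C n al *m aG (enum_val i)).

Lemma specht_translates_span :
  (specht_translates :=:
     cyclic_mx aG (young_symmetrizer C n al))%MS.
Proof.
apply/eqmxP/andP; split.
  apply/row_subP => i; rewrite rowK; apply: mxmodule_trans (cyclic_mx_module _ _) _ _.
    by rewrite inE.
  exact: cyclic_mx_id.
apply: cyclic_mx_sub.
  apply/mxmoduleP => x Gx; apply/row_subP => i; rewrite row_mul rowK -mulmxA.
  rewrite -repr_mxM ?inE //.
  set y := (_ * x)%g; rewrite -(@gring_indexK _ [group of G] y) ?inE //.
  by rewrite -(rowK (fun i => _ *m aG (enum_val i))) row_sub.
apply: submx_trans (row_sub (gring_index G 1%g) _).
by rewrite rowK gring_indexK ?inE // repr_mx1 mulmx1.
Qed.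

Lemma specht_spanned : spanned_by aG (specht C n al) specht_translates.
Proof.
set modU := cyclic_mx_module aG (young_symmetrizer C n al).
exists (val_submod 1%:M) => [|x].
  split; last exact: eqmx_trans (val_submod1 _) (eqmx_sym specht_translates_span).
  by rewrite /row_free val_submod1.
by rewrite -val_submodE -(val_submodJ modU) ?inE // mul1mx.
Qed.

End SpechtRank.

Lemma kronecker_rank (R : realType) (al be ga : seq nat) n :
  sumn al = n -> sumn be = n -> sumn ga = n ->
  let Z x s := specht_translates R[i] n s *m regular_repr R[i] [set: 'S_n] x in
  kronecker R al be ga =
    \rank (\sum_(x in [set: 'S_n])
             tprod (tprod (Z x al) (Z x be)) (Z x ga))%R.
Proof.
move=> Dal Dbe Dga Z; rewrite /kronecker Dbe Dga Dal eqxx.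
apply: tensor_invariants_rank; do ?exact: specht_spanned.
by rewrite pnatr_eq0 -lt0n cardG_gt0.
Qed.

Section SpechtEntries.

Variables (C : fieldType) (n : nat) (al : seq nat).
Local Notation G := [set: 'S_n].
Local Notation aG := (regular_repr C G).
Local Notation row := (reshape_index al).
Local Notation col := (reshape_offset al).

(** In a term q * p of the Young symmetrizer, p is determined by q and by the
    group element whose coefficient is taken; it remains to say that it preserves
    the rows. *)
Lemma specht_translates_entry (x : 'S_n) i j (u := enum_val i) (v := enum_val j) :
  (specht_translates C n al *m aG x) i j =
  altsum (fun k : 'I_n => col k) (fun q =>
    [forall k, row ((u^-1)%g ((x^-1)%g k)) == row (q ((v^-1)%g k))]%:R).
Proof.
have delta_repr (z y : 'S_n) : delta_mx 0 (gring_index G z) *m aG y =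
    delta_mx 0 (gring_index G (z * y)%g) :> 'rV[C]_#|G|.
  by rewrite -rowE rowK gring_indexK ?inE.
transitivity (((young_symmetrizer C n al) *m aG (u * x)%g) 0 j).
  rewrite repr_mxM ?inE // mulmxA [in RHS]mxE [in LHS]mxE.
  by apply: eq_bigr => k _; rewrite mxE.
rewrite /young_symmetrizer exchange_big /= mulmx_suml summxE.
apply: eq_bigr => q _; rewrite mulmx_suml summxE.
under eq_bigr => p _ do rewrite -scalemxAl delta_repr !mxE eqxx /=.
rewrite -mulr_sumr; congr (_ * _).
(* The variable w keeps associativity from unfolding the product u * x. *)
have [w Dw] : exists w, w = (u * x)%g by eexists.
rewrite -Dw; pose p0 := (q^-1 * v * w^-1)%g.
have E p : (j == gring_index G (q * p * w)) = (p == p0)%g.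
  rewrite -(inj_eq (can_inj (@gring_valK _ [group of G]))) gring_indexK ?inE //.
  rewrite -/v; apply/eqP/eqP => [Dv | ->]; last first.
    by rewrite /p0 -!mulgA mulKVg mulVg mulg1.
  by rewrite /p0 Dv -!mulgA mulKg mulgV mulg1.
have -> : [forall k, row ((u^-1)%g ((x^-1)%g k)) == row (q ((v^-1)%g k))] =
          (p0 \in row_stab n al).
  rewrite inE; apply/forallP/forallP => H k; last first.
    by have := H (q ((v^-1)%g k)); rewrite /p0 Dw invMg !permM permK permKV.
  by have := H (v ((q^-1)%g k)); rewrite /p0 Dw invMg !permM permK permKV.
under eq_bigr do rewrite E.
have [Rp0 | nRp0] := boolP (p0 \in _).
  rewrite (bigD1 p0) //= eqxx big1 ?addr0 // => p /andP[_ /negPf->//].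
by rewrite big1 // => p Rp; case: eqP => // Dp; rewrite Dp (negPf nRp0) in Rp.
Qed.

End SpechtEntries.

(** * Kronecker coefficients as dimensions of spaces of polynomials *)

Lemma ord_mul_split a b (i : 'I_(a * b)) :
  exists p : 'I_a * 'I_b, (i == p.1 * b + p.2 :> nat)%N.
Proof.
have b_gt0 : (0 < b)%N by case: b i => [|//] []; rewrite muln0.
have i1 : (i %/ b < a)%N by rewrite ltn_divLR.
have i2 : (i %% b < b)%N by rewrite ltn_pmod.
by exists (Ordinal i1, Ordinal i2); rewrite /= -divn_eq.
Qed.

Lemma ord_mul_join a b (p : 'I_a * 'I_b) : (p.1 * b + p.2 < a * b)%N.
Proof.
case: p => -[i ia] j /=; apply: (@leq_trans (i.+1 * b)).
  by rewrite mulSn addnC ltn_add2r.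
by rewrite leq_mul2r ia orbT.
Qed.

Section Variables.

Variables (K : comNzRingType) (L : nat).
Local Notation V := #|{: 'I_L.+1 * 'I_L.+1 * 'I_L.+1}|.

Definition box_var i j k : 'I_V :=
  enum_rank (inord i : 'I_L.+1, inord j : 'I_L.+1, inord k : 'I_L.+1).

Lemma box_var_eq i j k i' j' k' :
    [&& i <= L, j <= L & k <= L]%N -> [&& i' <= L, j' <= L & k' <= L]%N ->
  (box_var i j k == box_var i' j' k') = [&& i == i', j == j' & k == k'].
Proof.
case/and3P=> iL jL kL /and3P[iL' jL' kL'].
rewrite (inj_eq enum_rank_inj) !xpair_eqE -andbA -!val_eqE /=.
by rewrite !inordK.
Qed.

(** The variable x_ijk. Indices are truncated at L, and L + 1 will bound the
    lengths of all the partitions compared, so that their polynomials belong to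
    the same ring. *)
Definition box_mpoly i j k : {mpoly K[V]} := 'X_(box_var i j k).

End Variables.

Definition young_tab n al (y : 'S_n) : tableau 'I_n :=
  Tableau (fun i : 'I_n => reshape_index al i) (fun i : 'I_n => reshape_offset al i) y.

Section YoungPolynomials.

Variables (K : fieldType) (L n : nat) (al be ga : seq nat).
Local Notation V := #|{: 'I_L.+1 * 'I_L.+1 * 'I_L.+1}|.

Definition young_poly (y1 y2 y3 : 'S_n) : {mpoly K[V]} :=
  tabpoly (@box_mpoly K L) (young_tab al y1) (young_tab be y2) (young_tab ga y3).

Definition row_label (y1 y2 y3 : 'S_n) (k : 'I_n) : 'I_V :=
  box_var L (reshape_index al (y1 k)) (reshape_index be (y2 k))
            (reshape_index ga (y3 k)).

Lemma mcoeff_young_poly y1 y2 y3 m :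
  (young_poly y1 y2 y3)@_m =
  altsum (fun k : 'I_n => reshape_offset al k) (fun q1 =>
    altsum (fun k : 'I_n => reshape_offset be k) (fun q2 =>
      altsum (fun k : 'I_n => reshape_offset ga k) (fun q3 =>
        (content (row_label (y1 * q1) (y2 * q2) (y3 * q3)) == m)%:R))).
Proof.
rewrite /young_poly /tabpoly mcoeff_altsum; apply: eq_altsum => // q1.
rewrite mcoeff_altsum; apply: eq_altsum => // q2.
rewrite mcoeff_altsum; apply: eq_altsum => // q3.
rewrite -mcoeffX -prod_mpolyX; congr (_@__); apply: eq_bigr => k _.
by rewrite /box_mpoly /row_label !permM.
Qed.

Lemma mcoeff_young_poly0 y1 y2 y3 m :
    (forall z1 z2 z3, content (row_label z1 z2 z3) != m) ->
  (young_poly y1 y2 y3)@_m = 0.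
Proof.
move=> nm; rewrite mcoeff_young_poly.
rewrite [LHS]big1 // => q1 _; rewrite [altsum _ _]big1 ?mulr0 // => q2 _.
rewrite [altsum _ _]big1 ?mulr0 // => q3 _.
by rewrite (negPf (nm _ _ _)) mulr0.
Qed.

Local Notation G := [set: 'S_n].
Local Notation aG := (regular_repr K G).
Local Notation Z x s := (specht_translates K n s *m aG x).

Hypotheses (Dal : sumn al = n) (Dbe : sumn be = n) (Dga : sumn ga = n).
Hypotheses (alL : (size al <= L.+1)%N) (beL : (size be <= L.+1)%N).
Hypothesis gaL : (size ga <= L.+1)%N.

Lemma row_bound s (i : 'I_n) :
  sumn s = n -> (size s <= L.+1)%N -> (reshape_index s i <= L)%N.
Proof. by move=> Ds sL; rewrite -ltnS (leq_trans _ sL) // reshape_indexP // Ds. Qed.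

Lemma row_label_eq y1 y2 y3 z1 z2 z3 k l :
  (row_label y1 y2 y3 k == row_label z1 z2 z3 l) =
  [&& reshape_index al (y1 k) == reshape_index al (z1 l),
      reshape_index be (y2 k) == reshape_index be (z2 l)
    & reshape_index ga (y3 k) == reshape_index ga (z3 l)].
Proof. by rewrite box_var_eq // !row_bound. Qed.

(** The sum over x counts the renumberings of the points that turn the monomial of
    the column-permuted placement j into the monomial of the placement i: either
    there is none, or there are as many as in the stabilizer of the latter. *)
Lemma specht_tensor_entry i1 i2 i3 j1 j2 j3
    (u := fun s => (enum_val s : 'S_n)^-1%g) (l := row_label (u i1) (u i2) (u i3)) :
  \sum_x Z x al i1 j1 * Z x be i2 j2 * Z x ga i3 j3 =
  #|[set p : 'S_n | [forall k, l (p k) == l k]]|%:R *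
  (young_poly (u j1) (u j2) (u j3))@_(content l).
Proof.
rewrite mcoeff_young_poly.
under eq_bigr => x _ do rewrite !specht_translates_entry altsum_prod3.
rewrite altsum_sum -altsumZ; apply: eq_altsum => // q1.
rewrite altsum_sum -altsumZ; apply: eq_altsum => // q2.
rewrite altsum_sum -altsumZ; apply: eq_altsum => // q3.
rewrite (reindex_inj invg_inj) /= eq_sym -natrM -card_relabel -sum1_card.
rewrite natr_sum [RHS]big_mkcond; apply: eq_bigr => x _ /=.
rewrite inE invgK -!natrM !mulnb.
set b := (_ && _); set b' := [forall k, _].
suff -> : b = b' by case: b'.
apply/andP/forallP => [[/andP[/forallP E1 /forallP E2] /forallP E3] k | E].
  by rewrite row_label_eq !permM E1 E2 E3.
by split; [apply/andP; split|]; apply/forallP => k;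
   have := E k; rewrite row_label_eq !permM => /and3P[].
Qed.

End YoungPolynomials.

(** By [specht_tensor_entry] the columns of the matrix are the coefficient vectors
    of the polynomials, with each coefficient scaled by a nonzero integer that
    depends on the monomial only; and each monomial occurring in the polynomials
    comes from some placement, so no coefficient is missed. *)
Lemma kronecker_family_rank (R : realType) L n (al be ga : seq nat) :
    sumn al = n -> sumn be = n -> sumn ga = n ->
    (size al <= L.+1)%N -> (size be <= L.+1)%N -> (size ga <= L.+1)%N ->
  exists k (Y : 'I_k -> 'S_n * 'S_n * 'S_n),
    (forall y, exists i, Y i = y) /\
    family_rank (fun i => young_poly R[i] L al be ga (Y i).1.1 (Y i).1.2 (Y i).2)
      (kronecker R al be ga).
Proof.
move=> Dal Dbe Dga alL beL gaL.
set G := [set: 'S_n]; pose N := #|G|.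
pose dec a b (i : 'I_(a * b)) := xchoose (ord_mul_split i).
have decE a b (i : 'I_(a * b)) : i = ((dec a b i).1 * b + (dec a b i).2)%N :> nat.
  by apply/eqP/(xchooseP (ord_mul_split i)).
pose d1 (i : 'I_(N * N * N)) := (dec _ _ (dec _ _ i).1).1.
pose d2 (i : 'I_(N * N * N)) := (dec _ _ (dec _ _ i).1).2.
pose d3 (i : 'I_(N * N * N)) := (dec _ _ i).2.
pose u (i : 'I_N) := (enum_val i : 'S_n)^-1%g.
pose Y i := (u (d1 i), u (d2 i), u (d3 i)).
have Y_surj y : exists i, Y i = y.
  case: y => [[y1 y2] y3].
  pose e (z : 'S_n) : 'I_N := gring_index G z^-1%g.
  have ueK z : u (e z) = z by rewrite /u gring_indexK ?inE ?invgK.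
  pose p := Ordinal (ord_mul_join (e y1, e y2)).
  pose i := Ordinal (ord_mul_join (p, e y3)).
  exists i.
  have dec_eq a b (j : 'I_(a * b)) (q : 'I_a * 'I_b) :
      j = (q.1 * b + q.2)%N :> nat -> dec _ _ j = q.
    move=> Dj; have := decE _ _ j; rewrite Dj => E.
    case: q (dec a b j) E {Dj} => [q1 q2] [r1 r2] /= E.
    have b_gt0 : (0 < b)%N by case: b q2 r2 {j} E => [[]|].
    have E2 : q2 = r2.
      apply/val_inj; have := congr1 (modn^~ b) E => /=.
      by rewrite !modnMDl !modn_small.
    congr pair; last by [].
    apply/val_inj; have := congr1 (divn^~ b) E => /=.
    by rewrite !divnMDl // !divn_small // !addn0.
  have Ei : dec _ _ i = (p, e y3) by exact: dec_eq.
  have Ep : dec _ _ p = (e y1, e y2) by exact: dec_eq.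
  by rewrite /Y /d1 /d2 /d3 Ei Ep !ueK.
exists (N * N * N)%N, Y; split=> //.
rewrite (kronecker_rank R Dal Dbe Dga); set M := (\sum_(x in _) _)%R.
exists (N * N * N)%N, M^T; split; first by rewrite mxrank_tr.
pose l (i : 'I_(N * N * N)) := row_label L al be ga (Y i).1.1 (Y i).1.2 (Y i).2.
pose s i := #|[set p : 'S_n | [forall k, l i (p k) == l i k]]|.
pose P i := young_poly R[i] L al be ga (Y i).1.1 (Y i).1.2 (Y i).2.
have ME i j : M i j = (s i)%:R * (P j)@_(content (l i)).
  rewrite /M summxE -(specht_tensor_entry R[i] Dal Dbe Dga alL beL gaL).
  apply: eq_big => [x|x _]; first exact: in_setT.
  rewrite (tprod_entry _ _ (decE _ _ i) (decE _ _ j)).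
  by rewrite (tprod_entry _ _ (decE _ _ _) (decE _ _ _)).
have s_neq0 i : (s i)%:R != 0 :> R[i].
  rewrite pnatr_eq0 -lt0n card_gt0; apply/set0Pn; exists 1%g.
  by rewrite inE; apply/forallP => k; rewrite perm1.
have cM (c : 'rV_(N * N * N)) (i : 'I_(N * N * N)) :
    (c *m M^T) 0 i = (s i)%:R * (\sum_j c 0 j *: P j)@_(content (l i)).
  rewrite mxE (raddf_sum (mcoeff (content (l i)))) mulr_sumr; apply: eq_bigr => j _ /=.
  by rewrite mxE ME mcoeffZ mulrCA.
move=> c; split=> [cM0 | cP0]; last first.
  by apply/rowP => i; rewrite cM cP0 mcoeff0 mulr0 mxE.
apply/mpolyP => m; rewrite mcoeff0.
have [/existsP[[[z1 z2] z3] /eqP Dm] | /existsPn nm] :=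
    boolP [exists z : 'S_n * 'S_n * 'S_n,
      content (row_label L al be ga z.1.1 z.1.2 z.2) == m].
  have [i Yi] := Y_surj (z1, z2, z3).
  have /eqP := cM c i; rewrite cM0 mxE eq_sym mulf_eq0 (negPf (s_neq0 i)) /=.
  by rewrite /l Yi Dm => /eqP.
rewrite (raddf_sum (mcoeff m)) big1 // => j _ /=.
rewrite mcoeffZ mcoeff_young_poly0 ?mulr0 //.
by move=> z1 z2 z3; exact: (nm (z1, z2, z3)).
Qed.

(** * The rectangular triple has a nonzero polynomial *)

Lemma fibre_perms_group_set (I : finType) (T : eqType) (c : I -> T) :
  group_set (fibre_perms c).
Proof.
apply/group_setP; split=> [|q r /fibre_permP cq /fibre_permP cr].
  by apply/fibre_permP => i; rewrite perm1.
by apply/fibre_permP => i; rewrite permM cr cq.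
Qed.
Canonical fibre_group (I : finType) (T : eqType) (c : I -> T) :=
  Group (fibre_perms_group_set c).

Section SignedDoubleCosets.

Variables (I : finType) (H V : {group {perm I}}).
Hypothesis tiHV : H :&: V = 1%g.
Local Notation sgn q := ((-1) ^+ odd_perm q : int).

Lemma sgnM (q r : {perm I}) : sgn (q * r)%g = sgn q * sgn r.
Proof. by rewrite odd_permM signr_addb. Qed.

(** The coefficient of x in a v a, where a is the signed sum of H and v the sum
    of V. *)
Let weight (x : {perm I}) : int :=
  \sum_(p in H) \sum_(r in H) sgn p * sgn r * (p * x * r \in V)%g%:R.

Let weightMl h x : h \in H -> weight (h * x)%g = sgn h * weight x.
Proof.
move=> Hh; rewrite /weight mulr_sumr (reindex_inj (mulIg h^-1%g)) /=.
apply: eq_big => [p|p Hp]; first by rewrite groupMr ?groupV.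
rewrite mulr_sumr; apply: eq_bigr => r _.
by rewrite sgnM odd_permV -!mulgA mulKg !mulrA [sgn p * _]mulrC.
Qed.

Let weightMr h x : h \in H -> weight (x * h)%g = sgn h * weight x.
Proof.
move=> Hh; rewrite /weight mulr_sumr; apply: eq_bigr => p _; rewrite mulr_sumr.
rewrite (reindex_inj (mulgI h^-1%g)) /=.
apply: eq_big => [r|r Hr]; first by rewrite groupMl ?groupV.
by rewrite sgnM odd_permV -!mulgA mulKVg !mulrA [sgn p * _]mulrC.
Qed.

Let weight1 : weight 1%g = #|H|%:R.
Proof.
rewrite /weight -sum1_card natr_sum; apply: eq_bigr => p Hp.
rewrite (bigD1 p^-1%g) ?groupV //= mulg1 mulgV group1 mulr1.
rewrite odd_permV -signr_addb addbb big1 ?addr0 // => r /andP[Hr nr].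
have [|_] := boolP (p * r \in V)%g; last by rewrite mulr0.
move=> Vpr; have : (p * r)%g \in H :&: V by rewrite inE groupM.
by rewrite tiHV inE -eq_invg_mul eq_sym (negPf nr).
Qed.

(** With a the signed sum of H and v the sum of V in the group algebra, the
    quantity is the coefficient of 1 in a v a v. The coefficients of a v a
    alternate under H on either side, so that |H|^2 times this quantity is the sum
    of their squares; and the coefficient of 1 in a v a is |H|. *)
Lemma signed_double_coset_sum_gt0 :
  0 < \sum_(t in V) \sum_(p in H) \sum_(r in H)
        sgn p * sgn r * (p * t * r \in V)%g%:R.
Proof.
rewrite -[ltRHS]/(\sum_(t in V) weight t).
have E : #|H|%:R ^+ 2 * \sum_(t in V) weight t = \sum_x weight x ^+ 2.
  symmetry.
  transitivity (\sum_(p in H) \sum_(r in H) \sum_(t in V) weight t); last first.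
    by rewrite !sumr_const expr2 -mulrA !mulr_natl.
  under eq_bigr => x _.
    rewrite expr2 {1}/weight mulr_suml.
    under eq_bigr do rewrite mulr_suml.
    over.
  rewrite exchange_big; apply: eq_bigr => p Hp.
  rewrite exchange_big; apply: eq_bigr => r Hr /=.
  rewrite [RHS](reindex_inj (mulIg r)) [RHS](reindex_inj (mulgI p)) /=.
  rewrite [RHS]big_mkcond; apply: eq_bigr => x _ /=.
  rewrite weightMr // weightMl // mulrA [sgn r * _]mulrC.
  by case: (_ \in V); rewrite ?mulr1 // !(mulr0, mul0r).
have H_gt0 : 0 < #|H|%:R :> int by rewrite ltr0n cardG_gt0.
rewrite -(pmulr_rgt0 _ (exprn_gt0 2 H_gt0)) E (bigD1 1%g) //= weight1.
by rewrite ltr_wpDr ?exprn_gt0 // sumr_ge0 // => x _; rewrite sqr_ge0.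
Qed.

End SignedDoubleCosets.

Section RectangleBlock.

Variables (K : numDomainType) (L a b : nat).
Hypotheses (abL : (a * b <= L.+1)%N) (aL : (a <= L.+1)%N) (bL : (b <= L.+1)%N).
Let J := ('I_b * 'I_a)%type.

(** The diagrams of (1)^ab, (a)^b and (b)^a share the cells of a b x a grid as
    boxes, so that the identity places the points in all three. *)
Definition column_block : tableau J :=
  Tableau (fun p : J => enum_rank p : nat) (fun=> 0%N) id.
Definition row_block : tableau J :=
  Tableau (fun p : J => p.1 : nat) (fun p : J => p.2 : nat) id.
Definition row_block_tr : tableau J :=
  Tableau (fun p : J => p.2 : nat) (fun p : J => p.1 : nat) id.

Definition block_poly := tabpoly (@box_mpoly K L) column_block row_block row_block_tr.

Let label (s t r : J -> J) (p : J) :=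
  box_var L (enum_rank (s p)) (t p).1 (r p).2.

Let ord_le n (i : 'I_n) : (n <= L.+1)%N -> (i <= L)%N.
Proof. by move=> nL; rewrite -ltnS (leq_trans _ nL). Qed.

Let rank_le (p : J) : (enum_rank p <= L)%N.
Proof. by apply: ord_le; rewrite card_prod !card_ord mulnC. Qed.

Let label_eq s t r s' t' r' p p' :
  (label s t r p == label s' t' r' p') =
  [&& s p == s' p', (t p).1 == (t' p').1 & (r p).2 == (r' p').2].
Proof.
rewrite box_var_eq ?rank_le ?ord_le // !val_eqE.
by rewrite (inj_eq enum_rank_inj).
Qed.

Let label_content (s : {perm J}) t r :
  (content (label s t r) == content (label id id id)) =
  [forall p, ((s p).1 == (t p).1) && ((s p).2 == (r p).2)].
Proof.
apply/eqP/forallP => [E p | E].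
  have : (0 < content (label id id id) (label s t r p))%N.
    by rewrite -E contentE; apply/card_gt0P; exists p; rewrite inE.
  rewrite contentE => /card_gt0P[p']; rewrite inE label_eq => /and3P[/eqP-> /eqP-> /eqP->].
  by rewrite !eqxx.
rewrite /content [RHS](reindex_inj (@perm_inj _ s)); apply: eq_bigr => p _.
congr (U_(_))%MM; apply/eqP; rewrite label_eq eqxx /=.
by have /andP[/eqP-> /eqP->] := E p; rewrite !eqxx.
Qed.

(** The coefficient considered is that of the product of the x_(p, j, k) over the
    cells p = (j, k) of the grid. Permutations s, t, r contribute to it when s
    agrees with t on first coordinates and with r on second ones. Then t^-1 s
    preserves rows, r^-1 s preserves columns, and the coefficient becomes the sum
    of [signed_double_coset_sum_gt0] for the row and column stabilizers of the
    grid. *)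
Lemma block_poly_neq0 : block_poly != 0.
Proof.
apply/eqP => /(congr1 (mcoeff (content (label id id id)))); rewrite mcoeff0.
pose ok (s t r : {perm J}) := [forall p, ((s p).1 == (t p).1) && ((s p).2 == (r p).2)].
set V := fibre_perms (fun p : J => p.2 : nat).
set H := fibre_perms (fun p : J => p.1 : nat).
set N : int := \sum_(t in V) \sum_(p in H) \sum_(r in H)
        (-1) ^+ odd_perm p * (-1) ^+ odd_perm r * (p * t * r \in V)%g%:R.
have N_gt0 : 0 < N.
  apply: signed_double_coset_sum_gt0; apply/trivgP/subsetP => q.
  rewrite !inE => /andP[/forallP q1 /forallP q2]; apply/eqP/permP => p.
  apply/eqP; rewrite perm1 -pair_eqE /= /pair_eq /=.
  by move: (q1 p) (q2 p); rewrite !val_eqE => -> ->.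
suff -> : block_poly@_(content (label id id id)) = N%:~R.
  by move/eqP; rewrite intr_eq0 gt_eqF.
rewrite /block_poly /tabpoly mcoeff_altsum.
transitivity ((altsum (fun=> 0%N) (fun s : {perm J} =>
  altsum (fun p : J => p.2 : nat) (fun t => altsum (fun p : J => p.1 : nat) (fun r =>
    (ok s t r)%:R : int))))%:~R : K).
  rewrite altsum_intr; apply: eq_altsum => // s.
  rewrite mcoeff_altsum altsum_intr; apply: eq_altsum => // t.
  rewrite mcoeff_altsum altsum_intr; apply: eq_altsum => // r.
  rewrite (_ : \prod_j _ = 'X_[content (label s t r)]); last exact: prod_mpolyX.
  by rewrite mcoeffX label_content -/(ok s t r); case: (ok s t r).
congr _%:~R; rewrite /altsum /N; symmetry.
under [RHS]eq_bigr do rewrite mulr_sumr.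
rewrite [RHS]exchange_big; apply: eq_bigr => t Vt /=.
under [RHS]eq_bigr do rewrite mulr_sumr mulr_sumr.
rewrite [RHS]exchange_big /= (reindex_inj invg_inj) /=.
apply: eq_big => [p|p]; first by rewrite groupV.
rewrite groupV => Hp; rewrite [RHS](reindex_inj (mulgI t)) /=.
rewrite big_mkcond [RHS]big_mkcond; apply: eq_bigr => r _ /=.
have -> : (t * r)%g \in fibre_perms (fun=> 0%N) by apply/fibre_permP.
have okE : ok (t * r)%g t p = (r \in H) && (p^-1 * t * r \in V)%g.
  apply/forallP/andP => [E | [/fibre_permP Hr /fibre_permP Vr] q].
    split; apply/fibre_permP => q.
      by have /andP[/eqP] := E ((t^-1)%g q); rewrite permM permKV => ->.
    have /andP[_ /eqP] := E ((p^-1)%g q); rewrite !permM permKV => ->//.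
  rewrite permM -!val_eqE /= Hr eqxx /=.
  by have := Vr (p q); rewrite !permM permK => ->.
rewrite okE; case: (r \in H) => /=; last by rewrite !mulr0.
rewrite !odd_permM odd_permV; case: (_ \in V); last by rewrite !mulr0.
by move: (odd_perm p) (odd_perm t) (odd_perm r) => [] [] [].
Qed.

End RectangleBlock.

(** * Inserting rectangular blocks of columns *)

Section Boxes.

Variables (n : nat) (al : seq nat).
Hypothesis Dn : sumn al = n.

Lemma box_bound (i : 'I_n) : (reshape_offset al i < nth 0 al (reshape_index al i))%N.
Proof. by rewrite reshape_offsetP // Dn. Qed.

Lemma box_exists r c : (c < nth 0 al r)%N ->
  exists i : 'I_n, reshape_index al i = r /\ reshape_offset al i = c.
Proof.
move=> cr; have := flatten_indexP cr; rewrite Dn => lt_n.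
by exists (Ordinal lt_n); rewrite /= flatten_indexKl // flatten_indexKr.
Qed.

Lemma box_inj (i j : 'I_n) :
    reshape_index al i = reshape_index al j ->
    reshape_offset al i = reshape_offset al j ->
  i = j.
Proof.
by move=> Er Ec; apply/val_inj; rewrite /= -(reshape_indexK al i) Er Ec reshape_indexK.
Qed.

End Boxes.

(** Columns of length at least d + 1 are the first e ones, for e the part number d
    (counting from 0), and stay in place; the m columns of height d are inserted
    just after them, and the other columns are shifted by m. *)
Lemma insert_columns n n' (al al' : seq nat) d m (B : finType) (r c : B -> nat) :
    sumn al = n -> sumn al' = n' -> (n' <= n + #|B|)%N ->
    (forall i, nth 0 al' i = nth 0 al i + (if i < d then m else 0))%N ->
    (forall i, i < d -> nth 0 al d <= nth 0 al i)%N ->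
    (forall i, d <= i -> nth 0 al i <= nth 0 al d)%N ->
    (forall p, r p < d)%N -> (forall p, c p < m)%N ->
    (forall p q, r p = r q -> c p = c q -> p = q) ->
  exists (f1 : 'I_n -> 'I_n') (f2 : B -> 'I_n'),
    [/\ bijective (join_fun f1 f2),
        (forall i p, reshape_offset al' (f1 i) != reshape_offset al' (f2 p)),
        (forall i j, (reshape_offset al' (f1 i) == reshape_offset al' (f1 j)) =
                     (reshape_offset al i == reshape_offset al j)),
        (forall p q, (reshape_offset al' (f2 p) == reshape_offset al' (f2 q)) =
                     (c p == c q)) &
        (forall i, reshape_index al' (f1 i) = reshape_index al i) /\
        (forall p, reshape_index al' (f2 p) = r p)].
Proof.
move=> Dn Dn' n'_le al'E al_ge al_le rd cm rc_inj.
pose e := nth 0%N al d.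
pose shift k := (if k < e then k else k + m)%N.
have shift_inj k k' : (shift k == shift k') = (k == k').
  by rewrite /shift; case: (ltnP k e); case: (ltnP k' e) => ? ?; apply/eqP/eqP; lia.
have f1P (i : 'I_n) : exists j : 'I_n', (reshape_index al' j == reshape_index al i)
    && (reshape_offset al' j == shift (reshape_offset al i)).
  have [|j [Er Ec]] := @box_exists n' al' Dn' (reshape_index al i) (shift (reshape_offset al i)).
    have := box_bound Dn i; rewrite al'E /shift.
    move: (reshape_index al i) (reshape_offset al i) => k o.
    have := al_ge k; have := al_le k; rewrite -/e.
    by case: (ltnP k d) => ? ? ?; case: (ltnP o e) => ?; lia.
  by exists j; rewrite Er Ec !eqxx.
have f2P p : exists j : 'I_n', (reshape_index al' j == r p)
    && (reshape_offset al' j == e + c p)%N.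
  have [|j [Er Ec]] := @box_exists n' al' Dn' (r p) (e + c p)%N; last first.
    by exists j; rewrite Er Ec !eqxx.
  by rewrite al'E rd -addnS leq_add // al_ge.
pose f1 i := xchoose (f1P i); pose f2 p := xchoose (f2P p).
have r1 i : reshape_index al' (f1 i) = reshape_index al i.
  by have /andP[/eqP] := xchooseP (f1P i).
have c1 i : reshape_offset al' (f1 i) = shift (reshape_offset al i).
  by have /andP[_ /eqP] := xchooseP (f1P i).
have r2 p : reshape_index al' (f2 p) = r p.
  by have /andP[/eqP] := xchooseP (f2P p).
have c2 p : reshape_offset al' (f2 p) = (e + c p)%N.
  by have /andP[_ /eqP] := xchooseP (f2P p).
have disj i p : reshape_offset al' (f1 i) != reshape_offset al' (f2 p).
  rewrite c1 c2 /shift; have := cm p.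
  by case: (ltnP _ e) => ? ?; apply/eqP; lia.
exists f1, f2; split=> //; last 2 first.
- by move=> i j; rewrite !c1 shift_inj.
- by move=> p q; rewrite !c2 eqn_add2l.
apply: inj_card_bij; last by rewrite card_sum !card_ord.
move=> [i|p] [j|q] /= E.
- congr inl; apply: (box_inj (al := al)); first by rewrite -!r1 E.
  by apply/eqP; rewrite -shift_inj -!c1 E.
- by have := disj i q; rewrite E eqxx.
- by have := disj j p; rewrite E eqxx.
- congr inr; apply: rc_inj; first by rewrite -!r2 E.
  by apply/eqP; rewrite -(eqn_add2l e) -!c2 E.
Qed.

Lemma glue_perm (I1 I2 J : finType) (f1 g1 : I1 -> J) (f2 g2 : I2 -> J) :
    bijective (join_fun f1 f2) -> bijective (join_fun g1 g2) ->
  exists y : {perm J}, (forall i, y (f1 i) = g1 i) /\ (forall i, y (f2 i) = g2 i).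
Proof.
move=> [f' fK f'K] g_bij.
have y_inj : injective (join_fun g1 g2 \o f').
  by apply: inj_comp (bij_inj g_bij) (can_inj f'K).
exists (perm y_inj); split=> i; rewrite permE /=.
  by rewrite -[f1 i]/(join_fun f1 f2 (inl i)) fK.
by rewrite -[f2 i]/(join_fun f1 f2 (inr i)) fK.
Qed.

(** The two inequalities make the columns that go below the first d rows come
    first: they are those numbered less than [nth 0 al d]. *)
Definition rect_grow d m (al al' : seq nat) :=
  [/\ (forall i, nth 0 al' i = nth 0 al i + (if i < d then m else 0))%N,
      (forall i, i < d -> nth 0 al d <= nth 0 al i)%N,
      (forall i, d <= i -> nth 0 al i <= nth 0 al d)%N &
      sumn al' = (sumn al + d * m)%N].

(** Placements are extended by putting the new points in the inserted columns;
    this multiplies each polynomial of the first family by the fixed nonzero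
    [block_poly], so relations between the extended placements are relations
    between the original ones. *)
Lemma kronecker_grow (R : realType) a b (al be ga al' be' ga' : seq nat) :
    (0 < a)%N -> (0 < b)%N ->
    rect_grow (a * b) 1 al al' -> rect_grow b a be be' -> rect_grow a b ga ga' ->
  (kronecker R al be ga <= kronecker R al' be' ga')%N.
Proof.
move=> a_gt0 b_gt0 [al'E al_ge al_le Dal'] [be'E be_ge be_le Dbe'] [ga'E ga_ge ga_le Dga'].
have [/andP[/eqP Dbe /eqP Dga]|ne] := boolP ((sumn be == sumn al) && (sumn ga == sumn al));
  last by rewrite {1}/kronecker (negPf ne).
pose J := ('I_b * 'I_a)%type; pose n := sumn al; pose n' := (n + #|{: J}|)%N.
have cardJ : #|{: J}| = (a * b)%N by rewrite card_prod !card_ord mulnC.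
rewrite muln1 in Dal'; rewrite mulnC Dbe in Dbe'; rewrite Dga in Dga'.
rewrite -cardJ in Dal' Dbe' Dga'.
pose L := (size al + size be + size ga + size al' + size be' + size ga' + a * b + a + b)%N.
have [k [Y [_ dimP]]] : exists k (Y : 'I_k -> 'S_n * 'S_n * 'S_n),
    (forall y, exists i, Y i = y) /\
    family_rank (fun i => young_poly R[i] L al be ga (Y i).1.1 (Y i).1.2 (Y i).2)
      (kronecker R al be ga).
  by apply: kronecker_family_rank; rewrite // /L; lia.
have [k' [Y' [Y'_surj dimP']]] : exists k' (Y' : 'I_k' -> 'S_n' * 'S_n' * 'S_n'),
    (forall y, exists i, Y' i = y) /\
    family_rank (fun i => young_poly R[i] L al' be' ga' (Y' i).1.1 (Y' i).1.2 (Y' i).2)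
      (kronecker R al' be' ga').
  by apply: kronecker_family_rank; rewrite // /L; lia.
have enum_rank_lt (p : J) : (enum_rank p < a * b)%N.
  by rewrite -cardJ ltn_ord.
have enum_rank_eq (p q : J) : enum_rank p = enum_rank q :> nat -> p = q.
  by move=> E; apply/enum_rank_inj/val_inj.
have pair_eq1 (p q : J) : p.1 = q.1 :> nat -> p.2 = q.2 :> nat -> p = q.
  by case: p q => [p1 p2] [q1 q2] /= E1 E2; congr pair; apply/val_inj.
have [f1 [f2 [f_bij f_disj f_col1 f_col2 [f_row1 f_row2]]]] :=
  @insert_columns n n' al al' (a * b) 1 J _ _ erefl Dal' (leqnn _) al'E al_ge al_le
    enum_rank_lt (fun=> ltn0Sn 0) (fun p q E _ => enum_rank_eq p q E).
have [g1 [g2 [g_bij g_disj g_col1 g_col2 [g_row1 g_row2]]]] :=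
  @insert_columns n n' be be' b a J _ _ Dbe Dbe' (leqnn _) be'E be_ge be_le
    (fun p => ltn_ord p.1) (fun p => ltn_ord p.2) pair_eq1.
have [h1 [h2 [h_bij h_disj h_col1 h_col2 [h_row1 h_row2]]]] :=
  @insert_columns n n' ga ga' a b J _ _ Dga Dga' (leqnn _) ga'E ga_ge ga_le
    (fun p => ltn_ord p.2) (fun p => ltn_ord p.1) (fun p q E1 E2 => pair_eq1 p q E2 E1).
(* The new points are numbered by the boxes of the first diagram; y0 and z0 send
   them to the boxes of the two others, compatibly on old and inserted boxes. *)
have [y0 [y0l y0r]] := glue_perm f_bij g_bij.
have [z0 [z0l z0r]] := glue_perm f_bij h_bij.
pose lift y : 'S_n' := extend_perm (join_injl f_bij) y.
have liftl y i : lift y (f1 i) = f1 (y i) by rewrite /lift extend_permE.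
have liftr y p : lift y (f2 p) = f2 p.
  by rewrite /lift extend_perm_id // => i; rewrite join_disjoint.
pose Phi (y : 'S_n * 'S_n * 'S_n) := (lift y.1.1, lift y.1.2 * y0, lift y.2 * z0)%g.
have polyE y : young_poly R[i] L al' be' ga' (Phi y).1.1 (Phi y).1.2 (Phi y).2 =
    young_poly R[i] L al be ga y.1.1 y.1.2 y.2 * block_poly R[i] L a b.
  apply: (tabpoly_join _ f_bij).
  - apply: (@TabJoin _ _ _ f1 f2 (young_tab al' (lift y.1.1)) (young_tab al y.1.1)
              (column_block a b) f1 f2) => //.
      by move=> j; exact: liftl.
    by move=> j; exact: liftr.
  - apply: (@TabJoin _ _ _ f1 f2 (young_tab be' (lift y.1.2 * y0)%g) (young_tab be y.1.2)
              (row_block a b) g1 g2) => // j /=; rewrite permM.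
      by rewrite liftl y0l.
    by rewrite liftr y0r.
  - apply: (@TabJoin _ _ _ f1 f2 (young_tab ga' (lift y.2 * z0)%g) (young_tab ga y.2)
              (row_block_tr a b) h1 h2) => // j /=; rewrite permM.
      by rewrite liftl z0l.
    by rewrite liftr z0r.
have phiP i : exists j, Y' j == Phi (Y i).
  by have [j <-] := Y'_surj (Phi (Y i)); exists j.
apply: (family_rank_le (phi := fun i => xchoose (phiP i)) dimP dimP') => c E.
have nzF : block_poly R[i] L a b != 0 by apply: block_poly_neq0; rewrite /L; lia.
apply/(mulIf nzF); rewrite mul0r -[RHS]E mulr_suml; apply: eq_bigr => i _.
by rewrite (eqP (xchooseP (phiP i))) polyE scalerAl.
Qed.

(** * Divisibility by powers of a determinant *)

(** Either two rows coincide or the rows are permuted. *)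
Lemma det_rowsub (A : comNzRingType) d (s : 'I_d -> 'I_d) (M : 'M[A]_d) :
  \det (rowsub s M) = 0 \/ exists b : bool, \det (rowsub s M) = (-1) ^+ b * \det M.
Proof.
have [/injectiveP s_inj|/injectivePn[i [j ij Es]]] := boolP (injectiveb s).
  right; exists (odd_perm (perm s_inj)); rewrite -det_perm -det_mulmx -row_permE.
  by congr (\det _); apply/matrixP => i j; rewrite !mxE permE.
by left; apply: (determinant_alternate ij) => k; rewrite !mxE Es.
Qed.

Section Multiples.

Variables (K : comNzRingType) (V : nat) (f : {mpoly K[V]}).

Definition small_multiple D p := exists Q, p = f * Q /\ (msize Q <= D)%N.

Lemma small_multiple0 D : small_multiple D 0.
Proof. by exists 0; rewrite mulr0 msize0. Qed.

Lemma small_multipleD D p q :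
  small_multiple D p -> small_multiple D q -> small_multiple D (p + q).
Proof.
move=> [P [-> PD]] [Q [-> QD]]; exists (P + Q); rewrite mulrDr; split=> //.
by rewrite (leq_trans (msizeD_le _ _)) // geq_max PD.
Qed.

Lemma small_multiple_sign D p (b : bool) :
  small_multiple D p -> small_multiple D ((-1) ^+ b * p).
Proof.
move=> [P [-> PD]]; exists ((-1) ^+ b * P); rewrite mulrCA; split=> //.
by case: b; rewrite ?expr1 ?expr0 ?mulN1r ?mul1r ?msizeN.
Qed.

Lemma small_multiple_altsum D (I : finType) (T : eqType) (c : I -> T) F :
  (forall q, small_multiple D (F q)) -> small_multiple D (altsum c F).
Proof.
move=> DF; rewrite /altsum; elim/big_ind: _ => [|p q|q _].
- exact: small_multiple0.
- exact: small_multipleD.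
- exact: small_multiple_sign.
Qed.

End Multiples.

Section ColumnDeterminants.

Variables (K : comNzRingType) (L d : nat) (w : 'I_d -> nat * nat).
Local Notation V := #|{: 'I_L.+1 * 'I_L.+1 * 'I_L.+1}|.
Local Notation var i l := (box_mpoly K L i l.1 l.2).

Definition block_det : {mpoly K[V]} := \det (\matrix_(j < d, i < d) var i (w j)).

(** The function f lists the boxes of the column from top to bottom. *)
Definition full_column (I : finType) (r c : I -> nat) (l : I -> nat * nat) s :=
  exists f : 'I_d -> I,
    [/\ forall k, r (f k) = k, forall k, c (f k) = s,
        forall i, c i = s -> exists k, i = f k &
        forall k, exists j, l (f k) == w j].

(** By [altsum_join], a full column splits off as a factor. Its alternating sum is
    the expansion of a determinant whose rows are rows of the matrix of
    [block_det], possibly repeated or permuted. *)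
Lemma full_columns_divide (I : finType) (r c : I -> nat) (l : I -> nat * nat) S :
    uniq S -> {in S, forall s, full_column r c l s} ->
  small_multiple (block_det ^+ size S) (#|I| - d * size S).+1
    (altsum c (fun q => \prod_i var (r (q i)) (l i))).
Proof.
elim: S => [|s S IHS] /= in I r c l *.
  move=> _ _; rewrite expr0 muln0 subn0; apply: small_multiple_altsum => q.
  exists (\prod_i var (r (q i)) (l i)); rewrite mul1r; split=> //.
  rewrite [\prod_i _](prod_mpolyX K (fun i => box_var L (r (q i)) (l i).1 (l i).2)).
  by rewrite msizeX mdeg_content.
case/andP=> sS uniqS full; have [f [rf cf f_onto lf]] := full s (mem_head _ _).
pose J := {i : I | c i != s}.
have f_inj : injective f by move=> k k' E; apply/val_inj; rewrite /= -(rf k) E rf.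
have fJ_bij : bijective (join_fun f (val : J -> I)).
  have inv i : exists x : 'I_d + J, join_fun f val x == i.
    have [/eqP ci|ci] := boolP (c i == s); last by exists (inr (Sub i ci : J)).
    by have [k ->] := f_onto i ci; exists (inl k).
  have gK i : join_fun f (val : J -> I) (xchoose (inv i)) = i by apply/eqP/(xchooseP (inv i)).
  exists (fun i => xchoose (inv i)) => // x.
  move: (gK (join_fun f val x)); move: (xchoose _) => y.
  case: x y => [k|[i ci]] [k'|[i' ci']] /=.
  - by move/f_inj->.
  - by move=> E; case/eqP: (ci'); rewrite E cf.
  - by move=> E; case/eqP: (ci); rewrite -E cf.
  - by move=> E; congr inr; apply/val_inj.
have cardI : #|I| = (d + #|{: J}|)%N.
  by rewrite -(bij_eq_card fJ_bij) card_sum card_ord.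
rewrite (altsum_join fJ_bij) => [|k [i ci]]; last by rewrite cf eq_sym.
pose sg k := xchoose (lf k).
have sgE k : l (f k) = w (sg k) by apply/eqP/(xchooseP (lf k)).
pose M := \matrix_(j < d, i < d) var i (w j).
have [e [De E]] : exists e : {mpoly K[V]}, (e = 0 \/ exists b : bool, e = (-1) ^+ b) /\
    altsum (c \o f) (fun q => \prod_k var (r (f (q k))) (l (f k))) = e * block_det.
  have -> : altsum (c \o f) (fun q => \prod_k var (r (f (q k))) (l (f k))) =
      \det (rowsub sg M).
    rewrite /altsum /determinant; apply: eq_big => [q|q _].
      by apply/fibre_permP => k /=; rewrite !cf.
    by congr (_ * _); apply: eq_bigr => k _; rewrite !mxE rf sgE.
  have [->|[b ->]] := det_rowsub sg M; [exists 0 | exists ((-1) ^+ b)].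
    by rewrite mul0r; split; [left|].
  by split; [right; exists b|].
have IH : small_multiple (block_det ^+ size S) (#|{: J}| - d * size S).+1
    (altsum (c \o (val : J -> I)) (fun q => \prod_(i : J) var (r (val (q i))) (l (val i)))).
  apply: (IHS J (r \o val) (c \o val) (l \o val)) => // s' S's'.
  have [g [rg cg g_onto lg]] := full s' (mem_behead (s := s :: S) S's').
  have cgs k : c (g k) != s by rewrite cg; apply: contraNneq sS => <-.
  exists (fun k => Sub (g k) (cgs k)); split=> //= -[i ci] /= ci'.
  by have [k Dk] := g_onto i ci'; exists k; apply/val_inj.
case: IH => Q [EQ Qle].
have -> : altsum (c \o f) (fun q1 => altsum (c \o (val : J -> I)) (fun q2 =>
      \prod_i var (r (join_perm fJ_bij (q1, q2) i)) (l i))) =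
    block_det ^+ (size S).+1 * (e * Q).
  transitivity (e * block_det * (block_det ^+ size S * Q)); last first.
    by rewrite exprS !mulrA [e * _]mulrC -!mulrA; congr (_ * _); rewrite mulrCA.
  rewrite -E -EQ -altsum_prod; apply: eq_altsum => // q1; apply: eq_altsum => // q2.
  rewrite (big_join fJ_bij); congr (_ * _); apply: eq_bigr => k _.
    by rewrite join_permEl.
  by rewrite join_permEr.
exists (e * Q); split=> //.
rewrite cardI mulnS subnDl.
by case: De => [->|[b ->]]; rewrite ?mul0r ?msize0 //; case: b;
   rewrite ?expr1 ?expr0 ?mulN1r ?mul1r ?msizeN.
Qed.

End ColumnDeterminants.

(** Columns e, ..., h - 1 have height d; those that have a box with a label out of
    range are at most as many as such boxes. *)
Lemma many_full_columns n al d e h E (w : 'I_d -> nat * nat) (l : 'I_n -> nat * nat) :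
    sumn al = n ->
    (forall k, k < d -> h <= nth 0 al k)%N -> (forall k, d <= k -> nth 0 al k <= e)%N ->
    (E + #|[pred i | ~~ [exists j, l i == w j]]| <= h - e)%N ->
  exists S, [/\ uniq S, size S = E & {in S, forall s,
    full_column w (fun i : 'I_n => reshape_index al i)
                  (fun i : 'I_n => reshape_offset al i) l s}].
Proof.
move=> Dn high low; set bad := [pred i | _] => E_le.
pose ok s := [forall i : 'I_n, (reshape_offset al i == s) ==> ~~ bad i].
pose S0 := filter ok (index_iota e h).
have size_S0 : (E <= size S0)%N.
  have := count_predC ok (index_iota e h); rewrite size_iota size_filter.
  suff : (count (predC ok) (index_iota e h) <= #|bad|)%N by rewrite /index_iota; lia.
  rewrite cardE -size_filter -(size_map (fun i : 'I_n => reshape_offset al i)).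
  apply: uniq_leq_size => [|s]; first by rewrite filter_uniq // iota_uniq.
  rewrite mem_filter /= => /andP[/forallPn[k] + _]; rewrite negb_imply negbK.
  by case/andP=> /eqP<- bad_k; apply/mapP; exists k; rewrite ?mem_enum.
exists (take E S0); split.
- by rewrite take_uniq // filter_uniq // iota_uniq.
- by rewrite size_take_min; apply/minn_idPl.
move=> s /mem_take; rewrite mem_filter mem_index_iota => /and3P[/forallP ok_s es sh].
have boxP (k : 'I_d) : exists i : 'I_n,
    (reshape_index al i == k) && (reshape_offset al i == s).
  have [|i [Er Ec]] := @box_exists n al Dn k s.
    by rewrite (leq_trans sh) // high.
  by exists i; rewrite Er Ec !eqxx.
exists (fun k => xchoose (boxP k)).
have r k : reshape_index al (xchoose (boxP k)) = k.
  by have /andP[/eqP] := xchooseP (boxP k).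
have c k : reshape_offset al (xchoose (boxP k)) = s.
  by have /andP[_ /eqP] := xchooseP (boxP k).
split=> // [i ci | k].
  have row_i : (reshape_index al i < d)%N.
    rewrite ltnNge; apply/negP => /low; have := box_bound Dn i; rewrite ci; lia.
  by exists (Ordinal row_i); apply: (box_inj (al := al)); rewrite ?r ?c.
by have := ok_s (xchoose (boxP k)); rewrite c eqxx /= negbK => /existsP.
Qed.

(** Boxes are numbered row by row, so the boxes below the first b rows have the
    last numbers. *)
Lemma card_low_boxes n al b : sumn al = n ->
  (#|[pred i : 'I_n | b <= reshape_index al i]| <= sumn (drop b al))%N.
Proof.
move=> Dn; set m := sumn (take b al).
have Dm : n = (m + sumn (drop b al))%N by rewrite -Dn -{1}(cat_take_drop b al) sumn_cat.
rewrite cardE -(size_map (val : 'I_n -> nat)) -(size_iota m (sumn (drop b al))).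
apply: uniq_leq_size => [|_ /mapP[i + ->]].
  by rewrite map_inj_uniq ?enum_uniq //; apply: val_inj.
rewrite mem_enum inE => bi; rewrite mem_iota -Dm ltn_ord andbT.
rewrite -[leqRHS]/(nat_of_ord i) -(reshape_indexK al i) /flatten_index.
apply: leq_trans (leq_addr _ _); rewrite /m.
by rewrite -(subnKC bi) takeD sumn_cat leq_addr.
Qed.

Definition grid a b (j : 'I_(a * b)) := (j %/ a, j %% a)%N.

(** The permutations q2 and q3 are fixed first: they only change which points have
    out-of-range labels, not how many of them there are. *)
Lemma young_poly_divides (K : fieldType) L n a b (al be ga : seq nat) e h E
    (y1 y2 y3 : 'S_n) :
    sumn al = n -> sumn be = n -> sumn ga = n ->
    (forall k, k < a * b -> h <= nth 0 al k)%N ->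
    (forall k, a * b <= k -> nth 0 al k <= e)%N ->
    (E + (sumn (drop b be) + sumn (drop a ga)) <= h - e)%N ->
  small_multiple (block_det K L (@grid a b) ^+ E) (n - a * b * E).+1
    (young_poly K L al be ga y1 y2 y3).
Proof.
move=> Dal Dbe Dga high low E_le.
rewrite /young_poly /tabpoly altsum_exchange.
apply: small_multiple_altsum => q2; rewrite altsum_exchange.
apply: small_multiple_altsum => q3.
pose l i := (reshape_index be (q2 (y2 ((y1^-1)%g i))),
             reshape_index ga (q3 (y3 ((y1^-1)%g i)))).
have [|S [uniqS <- fullS]] := @many_full_columns n al (a * b) e h E (@grid a b) l Dal high low.
  apply: leq_trans E_le; rewrite leq_add2l.
  pose p2 := (y1^-1 * y2 * q2)%g; pose p3 := (y1^-1 * y3 * q3)%g.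
  pose B2 := [pred i : 'I_n | b <= reshape_index be i]%N.
  pose B3 := [pred i : 'I_n | a <= reshape_index ga i]%N.
  apply: (@leq_trans (#|[preim p2 of B2]| + #|[preim p3 of B3]|)); last first.
    have preim_le (p : 'S_n) (B : pred 'I_n) : (#|[preim p of B]| <= #|B|)%N.
      rewrite card_preim; last exact: perm_inj.
      by apply/subset_leq_card/subsetP => i; rewrite inE => /andP[].
    by rewrite leq_add // (leq_trans (preim_le _ _)) // card_low_boxes.
  rewrite -cardUI (leq_trans _ (leq_addr _ _)) //.
    apply/subset_leq_card/subsetP => i; rewrite !inE /p2 /p3 !permM.
    apply: contraR; rewrite negb_or -!ltnNge => /andP[rb ra].
    pose j := (Ordinal rb, Ordinal ra).
    have jlt := ord_mul_join j; rewrite [(b * a)%N]mulnC in jlt.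
    apply/existsP; exists (Ordinal jlt); rewrite /grid /l /=.
    by rewrite divnMDl ?(leq_ltn_trans _ ra) // divn_small // addn0 modnMDl modn_small.
have [Q [EQ Qle]] := full_columns_divide K L uniqS fullS.
exists Q; split; last by rewrite card_ord in Qle.
rewrite -EQ; apply: eq_altsum => // q1.
rewrite (reindex_inj (@perm_inj _ y1^-1%g)); apply: eq_bigr => i _ /=.
by rewrite permKV.
Qed.

(** Dividing all the polynomials by the same power of [block_det] does not affect
    their linear relations. *)
Lemma kronecker_bound (R : realType) L a b (al be ga : seq nat) e h E :
    (size al <= L.+1)%N -> (size be <= L.+1)%N -> (size ga <= L.+1)%N ->
    (forall k, k < a * b -> h <= nth 0 al k)%N ->
    (forall k, a * b <= k -> nth 0 al k <= e)%N ->
    (E + (sumn (drop b be) + sumn (drop a ga)) <= h - e)%N ->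
  (kronecker R al be ga <=
     #|{: 'X_{1..#|{: 'I_L.+1 * 'I_L.+1 * 'I_L.+1}| < (sumn al - a * b * E).+1}}|)%N.
Proof.
move=> alL beL gaL high low E_le.
have [/andP[/eqP Dbe /eqP Dga]|ne] := boolP ((sumn be == sumn al) && (sumn ga == sumn al));
  last by rewrite {1}/kronecker (negPf ne).
have [k [Y [_ dimP]]] := kronecker_family_rank R erefl Dbe Dga alL beL gaL.
have div i := young_poly_divides R[i] L (Y i).1.1 (Y i).1.2 (Y i).2
                erefl Dbe Dga high low E_le.
have [Q QP] : exists Q : 'I_k -> {mpoly R[i][#|{: 'I_L.+1 * 'I_L.+1 * 'I_L.+1}|]},
    forall i, young_poly R[i] L al be ga (Y i).1.1 (Y i).1.2 (Y i).2 =
      block_det R[i] L (@grid a b) ^+ E * Q i /\ (msize (Q i) <= (sumn al - a * b * E).+1)%N.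
  exact: (fin_all_exists div).
apply: (family_rank_bound (Q := Q) dimP) => [i|c E0]; first by have [] := QP i.
transitivity (block_det R[i] L (@grid a b) ^+ E * \sum_i c i *: Q i); last first.
  by rewrite E0 mulr0.
by rewrite mulr_sumr; apply: eq_bigr => i _; have [-> _] := QP i; rewrite -scalerAr.
Qed.

(** * Integer sequences shifted on their first entries *)

Lemma parts_nth_noninc s i j : is_partition s -> (i <= j)%N ->
  (nth 0 (parts s) j <= nth 0 (parts s) i)%N.
Proof.
case/andP=> s_sorted /allP s_ge0 le_ij.
have ge_tr : transitive (>=%R : rel int) by move=> y x z /= xy yz; apply: le_trans yz xy.
have [lt_j|ge_j] := ltnP j (size s); last by rewrite [nth _ _ j]nth_default ?size_map.
have lt_i := leq_ltn_trans le_ij lt_j.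
rewrite !(nth_map 0) //.
have : nth 0 s j <= nth 0 s i by apply: (sorted_leq_nth ge_tr) => //; exact: lexx.
have /= := s_ge0 _ (mem_nth 0 lt_j); have /= := s_ge0 _ (mem_nth 0 lt_i).
move: (nth 0 s i) (nth 0 s j) => x y; lia.
Qed.

Section AddFirst.

Variables (d : nat) (sp sm : seq int).
Hypotheses (size_sp : size sp = d) (sp_sorted : sorted >=%R sp).
Hypothesis sm_part : is_partition sm.
Local Notation u t := (add_first d t (sp ++ sm)).

Lemma add_firstE t : u t = [seq x + t | x <- sp] ++ sm.
Proof. by rewrite /add_first take_size_cat // drop_size_cat. Qed.

Lemma size_add_first t : size (parts (u t)) = size (sp ++ sm).
Proof. by rewrite size_map add_firstE !size_cat size_map. Qed.

Lemma is_partition_add_first t :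
  is_partition (u t) =
  all (fun x => all (fun y => y <= x + t) sm) sp && all (fun x => 0 <= x + t) sp.
Proof.
have ge_tr : transitive (>=%R : rel int) by move=> y x z /= xy yz; apply: le_trans yz xy.
have sorted_shift : sorted >=%R [seq x + t | x <- sp].
  by rewrite sorted_map; apply: sub_sorted sp_sorted => x y /=; rewrite lerD2r.
case/andP: sm_part => sm_sorted sm_ge0.
rewrite add_firstE /is_partition (sorted_pairwise ge_tr) pairwise_cat.
rewrite -!(sorted_pairwise ge_tr) sorted_shift sm_sorted !andbT all_cat sm_ge0 andbT.
by rewrite /allrel !all_map.
Qed.

Lemma add_first_partition_le t t' :
  t <= t' -> is_partition (u t) -> is_partition (u t').
Proof.
move=> le_t; rewrite !is_partition_add_first => /andP[/allP sm_le /allP sp_ge].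
apply/andP; split; apply/allP => x xs; last by rewrite (le_trans (sp_ge x xs)) ?lerD2l.
by apply: sub_all (sm_le x xs) => y le_y; rewrite (le_trans le_y) ?lerD2l.
Qed.

Lemma add_first_partition_large : exists t0, is_partition (u t0).
Proof.
have le_sum s (x : int) : x \in s -> `|x| <= \sum_(y <- s) `|y|.
  elim: s => // y s IHs; rewrite inE big_cons => /orP[/eqP->|/IHs xs].
    by rewrite lerDl sumr_ge0.
  by rewrite (le_trans xs) // lerDr.
exists ((\sum_(y <- sp) `|y|) + \sum_(y <- sm) `|y|).
have sum_ge0 s : 0 <= \sum_(y <- s) `|y : int| by rewrite sumr_ge0.
rewrite is_partition_add_first; apply/andP; split; apply/allP => x xs.
  apply/allP => y ys; have := le_sum _ _ xs; have := le_sum _ _ ys.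
  move: (\sum_(_ <- sp) _) (\sum_(_ <- sm) _) => S S'; lia.
have := le_sum _ _ xs; have := sum_ge0 sm.
move: (\sum_(_ <- sp) _) (\sum_(_ <- sm) _) => S S'; lia.
Qed.

Lemma parts_add_first_grow t m : is_partition (u t) ->
  rect_grow d m (parts (u t)) (parts (u (t + m%:Z))).
Proof.
move=> ut; have := ut; rewrite is_partition_add_first => /andP[_ /allP sp_ge0].
split.
- move=> i; rewrite !add_firstE /parts !map_cat !nth_cat !size_map size_sp.
  case: ltnP => [lt_i|_]; last by rewrite addn0.
  rewrite !(nth_map 0) ?size_map ?size_sp //.
  have /= : 0 <= nth 0 sp i + t by apply: sp_ge0; rewrite mem_nth ?size_sp.
  move: (nth 0 sp i) => x; lia.
- by move=> i lt_i; apply: parts_nth_noninc => //; exact: ltnW.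
- by move=> i le_i; apply: parts_nth_noninc.
rewrite !add_firstE /parts !map_cat !sumn_cat addnAC -size_sp; congr (_ + _)%N.
elim: (sp) sp_ge0 => [|x s IHs] x_ge0 //=.
rewrite IHs => [|y ys]; last by rewrite x_ge0 ?inE ?ys ?orbT.
have /= := x_ge0 x (mem_head _ _); rewrite mulSn; lia.
Qed.

Lemma drop_parts_add_first t : drop d (parts (u t)) = parts sm.
Proof. by rewrite add_firstE /parts map_cat drop_size_cat // !size_map. Qed.

End AddFirst.

(** * Stability *)

Lemma bounded_nondecreasing_stabilizes (G : nat -> nat) B :
    (forall k, G k <= G k.+1)%N -> (forall k, G k <= B)%N ->
  exists k0, forall k, (k0 <= k)%N -> G k = G k0.
Proof.
move=> G_mono G_le; pose P v := boolp.asbool (exists k, G k = v).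
have exP : exists v, P v by exists (G 0%N); apply/boolp.asboolP; exists 0%N.
have leP v : P v -> (v <= B)%N by move=> /boolp.asboolP[k <-].
case: (ex_maxnP exP leP) => v /boolp.asboolP[k0 Dv] v_max; exists k0 => k le_k.
apply/eqP; rewrite eqn_leq; apply/andP; split.
  by rewrite Dv; apply: v_max; apply/boolp.asboolP; exists k.
elim: k le_k => [|k IHk]; first by rewrite leqn0 => /eqP->.
by rewrite leq_eqVlt => /orP[/eqP->|/IHk /leq_trans->].
Qed.

Theorem proposition4 (R : realType) (a b : nat) (a_gt0 : (0 < a)%N)
    (b_gt0 : (0 < b)%N)
    (lambda_p mu_p nu_p lambda_m mu_m nu_m : seq int)
    (size_lambda_p : size lambda_p = (a * b)%N)
    (size_mu_p : size mu_p = b)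
    (size_nu_p : size nu_p = a)
    (lambda_p_sorted : sorted >=%R lambda_p)
    (mu_p_sorted : sorted >=%R mu_p)
    (nu_p_sorted : sorted >=%R nu_p)
    (lambda_m_part : is_partition lambda_m)
    (mu_m_part : is_partition mu_m)
    (nu_m_part : is_partition nu_m) :
  let lambda (t : int) := add_first (a * b) t (lambda_p ++ lambda_m) in
  let mu (t : int) := add_first b (a%:Z * t) (mu_p ++ mu_m) in
  let nu (t : int) := add_first a (b%:Z * t) (nu_p ++ nu_m) in
  let valid (t : int) :=
    [&& is_partition (lambda t), is_partition (mu t) & is_partition (nu t)] in
  let g (t : int) :=
    kronecker R (parts (lambda t)) (parts (mu t)) (parts (nu t)) in
  [/\ (exists t0 : int, forall t : int, t0 <= t -> valid t),
      (forall s t : int, valid s -> valid t -> s <= t -> (g s <= g t)%N) &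
      (exists (t0 : int) (c : nat),
         forall t : int, t0 <= t -> valid t -> g t = c)].
Proof.
move=> lambda mu nu valid g.
have valid_le s t : s <= t -> valid s -> valid t.
  move=> le_st /and3P[ls ms ns]; apply/and3P; split.
  - exact: add_first_partition_le ls.
  - by apply: add_first_partition_le ms => //; rewrite ler_wpM2l.
  - by apply: add_first_partition_le ns => //; rewrite ler_wpM2l.
have [t0 t0_ge0 valid_t0] : exists2 t0, 0 <= t0 & valid t0.
  have [t1 lt1] := add_first_partition_large size_lambda_p lambda_p_sorted lambda_m_part.
  have [t2 mt2] := add_first_partition_large size_mu_p mu_p_sorted mu_m_part.
  have [t3 nt3] := add_first_partition_large size_nu_p nu_p_sorted nu_m_part.
  exists (`|t1| + `|t2| + `|t3|); first by rewrite !addr_ge0.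
  set t := _ + _; have t_ge0 : 0 <= t by rewrite /t; lia.
  have aZ : 1 <= a%:Z by rewrite lez_nat.
  have bZ : 1 <= b%:Z by rewrite lez_nat.
  apply/and3P; split.
  - by apply: add_first_partition_le lt1 => //; rewrite /t; lia.
  - apply: add_first_partition_le mt2 => //; apply: (@le_trans _ _ t).
      by rewrite /t; lia.
    by rewrite ler_peMl.
  - apply: add_first_partition_le nt3 => //; apply: (@le_trans _ _ t).
      by rewrite /t; lia.
    by rewrite ler_peMl.
have lambda_grow t (m : nat) : valid t ->
    rect_grow (a * b) m (parts (lambda t)) (parts (lambda (t + m%:Z))).
  by case/and3P => lt _ _; apply: parts_add_first_grow.
have g_step t : valid t -> (g t <= g (t + 1)%R)%N.
  move=> valid_t; have /and3P[_ mt nt] := valid_t.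
  apply: (kronecker_grow R a_gt0 b_gt0); first exact: (lambda_grow t 1%N).
    by rewrite /mu mulrDr mulr1; apply: parts_add_first_grow.
  by rewrite /nu mulrDr mulr1; apply: parts_add_first_grow.
split; first by exists t0 => t le_t; exact: valid_le valid_t0.
  move=> s t valid_s _ le_st.
  have [k ->] : exists k : nat, t = s + k%:Z by exists `|t - s|%N; lia.
  elim: k => [|k IHk]; first by rewrite addr0.
  rewrite (leq_trans IHk) // -addn1 PoszD addrA; apply: g_step.
  by apply: valid_le valid_s; rewrite lerDl.
pose M := (sumn (parts mu_m) + sumn (parts nu_m))%N.
pose d := (a * b)%N; have d_gt0 : (0 < d)%N by rewrite muln_gt0 a_gt0.
(* From t1 on, the columns of height d outnumber by at least t - t1 the points
   that may carry a label out of the grid. *)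
pose t1 := t0 + M%:Z.
have valid_t1 (k : nat) : valid (t1 + k%:Z).
  by apply: valid_le valid_t0; rewrite /t1; lia.
pose L := (size (lambda_p ++ lambda_m) + size (mu_p ++ mu_m) + size (nu_p ++ nu_m))%N.
pose D := (sumn (parts (lambda t1))).+1.
pose V := #|{: 'I_L.+1 * 'I_L.+1 * 'I_L.+1}|.
have [k0 G_const] : exists k0, forall k, (k0 <= k)%N ->
    g (t1 + k%:Z) = g (t1 + k0%:Z).
  apply: (@bounded_nondecreasing_stabilizes (fun k => g (t1 + k%:Z)) #|{: 'X_{1..V < D}}|).
    by move=> k; rewrite -addn1 PoszD addrA; exact: g_step.
  move=> k; set t := t1 + _.
  have /and3P[lt mt nt] := valid_t1 k.
  have [t_nth t0_le _ _] := lambda_grow t0 (M + k)%N valid_t0.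
  have Dt : t0 + (M + k)%:Z = t by rewrite PoszD addrA.
  have [_ _ _ t1_sum] : rect_grow d k (parts (lambda t1)) (parts (lambda t)).
    by apply: lambda_grow; rewrite -[t1]addr0; apply: (valid_t1 0%N).
  have -> : D = (sumn (parts (lambda t)) - d * k).+1.
    by rewrite /D t1_sum; congr _.+1; exact: esym (addnK _ _).
  apply: (@kronecker_bound R L a b _ _ _ (nth 0%N (parts (lambda t)) d)
            (nth 0%N (parts (lambda t)) d.-1) k).
  - by rewrite size_add_first // leqW // /L -addnA leq_addr.
  - by rewrite size_add_first // leqW // /L addnAC leq_addl.
  - by rewrite size_add_first // leqW // /L leq_addl.
  - move=> i lt_i; apply: (parts_nth_noninc lt).
    by rewrite -ltnS prednK.
  - by move=> i; apply: (parts_nth_noninc lt).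
  rewrite !drop_parts_add_first //.
rewrite -/M -Dt !t_nth ltnn addn0 prednK // leqnn.
  rewrite -addnBAC; first by rewrite [(k + M)%N]addnC leq_addl.
  by apply: t0_le; rewrite prednK.
exists (t1 + k0%:Z), (g (t1 + k0%:Z)) => t le_t _.
have -> : t = t1 + `|t - t1|%N%:Z by lia.
by apply: G_const; lia.
Qed.
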